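(* Let $G$ be a connected $(\text{claw}, \text{diamond}, N_{2,2,2})$-free graph. If $G$ contains an induced $C_5$, then $G$ contains $K_4$, or $G$ contains $B_{10}$, or $G$ contains $L(P^* )$, or $G$ contains the line graph $L(H)$ of an overfull graph $H$ consisting of a cycle of length $9$ together with $4$ chords, or $G$ is $3$-colorable.
   Context: All graphs are finite, simple and undirected. For graphs $G$ and $F$, ''$G$ contains $F$'' means that some induced subgraph of $G$ is isomorphic to $F$; $G$ is $(F_1,\dots,F_m)$-free if it contains none of them. The claw is $K_{1,3}$; the diamond is $K_4$ minus one edge. $N_{2,2,2}$ is the graph obtained from a triangle by attaching to each of its three vertices a pendant path of length $2$ (9 vertices in total, the three paths pairwise disjoint). $L(\cdot)$ denotes the line graph. $B_{10}=L(D_7)$ where $D_7$ is $K_{3,3}$ with one edge subdivided once. $P^*$ is the Petersen graph with one vertex deleted. A graph $H$ is overfull if $|E(H)| > \alpha'(H)\Delta(H)$, where $\alpha'(H)$ is the maximum size of a matching and $\Delta(H)$ the maximum degree. ''A cycle of length $9$ with $4$ chords'' means a graph on $9$ vertices having a Hamiltonian cycle and exactly $4$ further edges. A graph is $3$-colorable if it admits a proper vertex coloring with at most $3$ colors. *)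

(* Defs.v *)
From mathcomp Require Import all_boot.

Set Implicit Arguments.
Unset Strict Implicit.
Unset Printing Implicit Defensive.

Record sgraph := SGraph {
  vertex :> finType;
  adj : rel vertex;
  adj_sym : symmetric adj;
  adj_irr : irreflexive adj }.

Notation "x -- y" := (adj x y) (at level 30, no associativity).

Section GraphOfRel.
Variables (T : finType) (r : rel T).

Definition sym_rel : rel T := fun x y => (x != y) && (r x y || r y x).

Fact sym_rel_sym : symmetric sym_rel.
Proof. by move=> x y; rewrite /sym_rel eq_sym orbC. Qed.

Fact sym_rel_irr : irreflexive sym_rel.
Proof. by move=> x; rewrite /sym_rel eqxx. Qed.

(* [r] need only list each edge in one direction; loops are discarded. *)
Definition graph_of_rel : sgraph := SGraph sym_rel_sym sym_rel_irr.
End GraphOfRel.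

Definition isomorphic (G H : sgraph) : Prop :=
  exists f : G -> H, bijective f /\ forall x y, (f x -- f y) = (x -- y).

Definition induced (G : sgraph) (S : {set G}) : sgraph :=
  @graph_of_rel {x : G | x \in S} (fun u v => val u -- val v).

Definition contains (G F : sgraph) : Prop :=
  exists S : {set G}, isomorphic (induced S) F.

Definition connected (G : sgraph) : Prop :=
  forall x y : G, connect (@adj G) x y.

Definition colorable (k : nat) (G : sgraph) : Prop :=
  exists c : G -> 'I_k, forall x y, x -- y -> c x != c y.

Definition edges (G : sgraph) : {set {set G}} :=
  [set [set p.1; p.2] | p : G * G & p.1 -- p.2].

Definition line_graph (G : sgraph) : sgraph :=
  @graph_of_rel {e : {set G} | e \in edges G}
    (fun e f => val e :&: val f != set0).

Definition max_degree (G : sgraph) : nat :=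
  \max_(x : G) #|[set y | x -- y]|.

Definition matching (G : sgraph) (M : {set {set G}}) : bool :=
  (M \subset edges G) && trivIset M.

Definition matching_number (G : sgraph) : nat :=
  \max_(M : {set {set G}} | matching M) #|M|.

Definition overfull (G : sgraph) : Prop :=
  matching_number G * max_degree G < #|edges G|.

Definition cycle_edges (G : sgraph) (s : seq G) : {set {set G}} :=
  [set [set x; next s x] | x in s].

(* For 3 <= n: [ucycle] also accepts the degenerate cycles of size 0 and 2. *)
Definition cycle_with_chords (n k : nat) (H : sgraph) : Prop :=
  #|H| = n /\
  exists s : seq H,
    [/\ ucycle (@adj H) s, size s = n & #|edges H :\: cycle_edges s| = k].

Definition complete_graph (n : nat) : sgraph :=
  @graph_of_rel 'I_n (fun _ _ => true).

Definition complete_bipartite (m n : nat) : sgraph :=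
  @graph_of_rel ('I_m + 'I_n)%type
    (fun u v => if (u, v) is (inl _, inr _) then true else false).

(* A cycle only for 3 <= n. *)
Definition cycle_graph (n : nat) : sgraph :=
  @graph_of_rel 'I_n (fun i j => j == i.+1 %% n :> nat).

Definition delete_edge (G : sgraph) (x y : G) : sgraph :=
  @graph_of_rel G (fun u v => (u -- v) && ([set u; v] != [set x; y])).

Definition delete_vertex (G : sgraph) (x : G) : sgraph := induced [set~ x].

(* Meant for adjacent x and y; the subdividing vertex is [None]. *)
Definition subdivide_edge (G : sgraph) (x y : G) : sgraph :=
  @graph_of_rel (option G)
    (fun u v => match u, v with
                | Some a, Some b => (a -- b) && ([set a; b] != [set x; y])
                | None, Some b => b \in [set x; y]
                | _, None => false
                end).

Definition claw : sgraph := complete_bipartite 1 3.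

Definition diamond : sgraph :=
  @delete_edge (complete_graph 4) (inord 0 : 'I_4) (inord 1 : 'I_4).

(* The vertex (i, j) is at distance j from the triangle on the i-th path. *)
Definition N222 : sgraph :=
  @graph_of_rel ('I_3 * 'I_3)%type
    (fun u v => if u.1 == v.1 then v.2 == u.2.+1 :> nat
                else (u.2 == ord0) && (v.2 == ord0)).

(* Which edge of K_{3,3} is subdivided is immaterial by symmetry. *)
Definition D7 : sgraph :=
  @subdivide_edge (complete_bipartite 3 3) (inl ord0) (inr ord0).

Definition B10 : sgraph := line_graph D7.

(* Outer 5-cycle on (false, i), inner pentagram on (true, i), and spokes. *)
Definition petersen : sgraph :=
  @graph_of_rel (bool * 'I_5)%type
    (fun u v => match u.1, v.1 with
                | false, false => v.2 == u.2.+1 %% 5 :> nat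
                | true, true => v.2 == u.2.+2 %% 5 :> nat
                | false, true => u.2 == v.2
                | true, false => false
                end).

(* The Petersen graph is vertex-transitive, so the choice is immaterial. *)
Definition petersen_minus_vertex : sgraph :=
  @delete_vertex petersen (false, ord0).

(* Main.v *)
(** A claw-, diamond- and K4-free graph G is the line graph of a subcubic
triangle-free graph H, and G is 3-colourable iff H is 3-edge-colourable. Since
G has no induced N222, H has no subgraph S333 (the spider with three legs of
length 3); likewise a subgraph D7 or P* of H gives its line graph in G, and by
counting degrees a 9-cycle with at least 4 chords in H is overfull and has
exactly 4 chords. Let X be a minimal set of edges of H that is not
3-edge-colourable. Removing edges from X and recolouring (with Kempe chains)
shows that X has minimum degree 2, that its vertices of degree 2 are at distance
at least 3, and that no 3-edge-colourable part of X is attached to the rest by a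
single edge.

Suppose H has a 5-cycle. If no edge of it lies in X, then a path of length 3
leaves the vertices of X towards the 5-cycle; otherwise some edges of the
5-cycle lie in X. From either start, the local structure of X grows in only
finitely many ways before it violates one of these constraints, and the case
tree is checked by computation. *)
Require Import Defs.
From mathcomp Require Import all_boot all_fingroup zify.
From Stdlib Require Import Classical.

Set Implicit Arguments.
Unset Strict Implicit.
Unset Printing Implicit Defensive.

(** The search works with subgraphs of H that need not be induced: two vertices of a line graph are
    adjacent exactly when the edges they stand for share an end, so every subgraph of H gives an
    induced line graph in G. Hence a state records only edges known to be present, and an occurrence
    of a forbidden pattern survives any further edges between its vertices.

    The obstacle is that the degrees of H are bounded only from above, so H alone forces nothing to
    continue. The critical set X supplies the lower bound: its vertices have degree 2 or 3 in X, so
    the next critical edge at a vertex is either absent in one way only (degree 2), or leads to a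
    known vertex, or to a new one. Branching is confined to such edges; edges outside X enter only
    with the starting configuration. The scripts carry no proof obligation: [refute] replays them,
    and its soundness holds for every script. *)

(** * Refutation of partial subcubic graphs *)

(* A partially known graph on the vertices [0 .. order - 1]: [inner] lists known
   edges in the critical part, [outer] known edges outside it, [twos] the
   vertices of degree 2 in the critical part and [outs] vertices not in it. *)
Record state := State {
  order : nat;
  inner : seq (nat * nat);
  outer : seq (nat * nat);
  twos : seq nat;
  outs : seq nat }.

Definition nbs (E : seq (nat * nat)) (v : nat) : seq nat :=
  undup [seq (if e.1 == v then e.2 else e.1) | e <- E & (e.1 == v) || (e.2 == v)].

Definition table (E : seq (nat * nat)) (n : nat) : nat -> seq nat :=
  let T := [seq nbs E v | v <- iota 0 n] in nth [::] T.

(** A vertex with known edges of both kinds has exactly two critical edges: at least two by minimum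
    degree, and at most two since one of its three places is taken. For the same reason a vertex on
    a critical edge has at most one outer edge. *)
Definition clash (st : state) : bool :=
  let inn := table (inner st) (order st) in
  let out := table (outer st) (order st) in
  let nb v := inn v ++ out v in
  let two v := (v \in twos st) || (inn v != [::]) && (out v != [::]) in
  has (fun v =>
    [|| 3 < size (nb v),
        (inn v != [::]) && (1 < size (out v)),
        (inn v != [::]) && (v \in outs st),
        (v \in twos st) && (2 < size (inn v)),
        has (fun a => has (fun b => b \in nb v) (nb a)) (nb v)
      | two v && has (fun a => two a ||
          has (fun b => (b != v) && two b) (inn a)) (inn v)])
    (iota 0 (order st)).

(* A pattern [P] lists, for each of its vertices, the adjacent earlier vertices. *)
Fixpoint embeds (adj : nat -> seq nat) (fin : pred (seq nat))
    (P : seq (seq nat)) (n : nat) (s : seq nat) : bool :=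
  if P is js :: P' then
    has (fun x => [&& x \notin s, all (fun j => x \in adj (nth 0 s j)) js
                    & embeds adj fin P' n (rcons s x)])
        (if js is j :: _ then adj (nth 0 s j) else iota 0 n)
  else fin s.

(* The centre is 0, and the legs are 123, 456 and 789. *)
Definition spider : seq (seq nat) :=
  [:: [::]; [:: 0]; [:: 1]; [:: 2]; [:: 0]; [:: 4]; [:: 5]; [:: 0]; [:: 7]; [:: 8]].

(* The classes are 024 and 135, and the edge between 0 and 5 is subdivided by 6. *)
Definition K33_subdivided : seq (seq nat) :=
  [:: [::]; [:: 0]; [:: 1]; [:: 2; 0]; [:: 3; 1]; [:: 4; 2]; [:: 5; 0]].

(* The outer path is 0123, and the inner vertices 4, 7, 5, 6 are joined to it in
   this order; 8 is the inner neighbour of the deleted vertex. *)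
Definition petersen_minus : seq (seq nat) :=
  [:: [::]; [:: 0]; [:: 1]; [:: 2]; [:: 0]; [:: 2; 4]; [:: 3; 4]; [:: 1; 6]; [:: 5; 7]].

Definition cycle9 : seq (seq nat) :=
  [:: [::]; [:: 0]; [:: 1]; [:: 2]; [:: 3]; [:: 4]; [:: 5]; [:: 6]; [:: 7; 0]].

Definition pairs9 : seq (nat * nat) := [seq (i, j) | i <- iota 0 9, j <- iota 0 i].

Definition touch (T : eqType) (e f : T * T) : bool :=
  [|| e.1 == f.1, e.1 == f.2, e.2 == f.1 | e.2 == f.2].

Fixpoint colours (E : seq (nat * nat)) (D : seq ((nat * nat) * nat)) : bool :=
  if E is e :: E' then
    has (fun c => all (fun d => touch e d.1 ==> (c != d.2)) D
                  && colours E' ((e, c) :: D)) (iota 0 3)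
  else true.

(** Holds when every critical edge at a vertex of the known critical part is listed; a vertex
    without listed critical edges does not belong to that part and counts as saturated. *)
Definition saturated (st : state) (v : nat) : bool :=
  let i := size (nbs (inner st) v) in
  [|| i == 0, i == 3
    | (i == 2) && ((v \in twos st) || (nbs (outer st) v != [::]))].

(** One exceptional vertex with two known critical edges is tolerated: at most one edge then
    attaches the known critical part to the rest, and the colours of that part can be permuted to
    fit. *)
Definition all_saturated (st : state) : bool :=
  let us := [seq v <- iota 0 (order st) | ~~ saturated st v] in
  if us is v :: us' then (us' == [::]) && (size (nbs (inner st) v) == 2)
  else true.

Definition join (st : state) (v w : nat) : state :=
  State (maxn (order st) w.+1) ((v, w) :: inner st) (outer st) (twos st) (outs st).

(** Stopping at degree 2 is possible only after two edges are known, by minimum degree 2. The choice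
    [w = order st] is a new vertex. *)
Definition children (st : state) (v : nat) : seq state :=
  (if size (nbs (inner st) v) == 2 then
    [:: State (order st) (inner st) (outer st) (v :: twos st) (outs st)] else [::])
  ++ [seq join st v w | w <- iota 0 (order st).+1
      & (w != v) && (w \notin nbs (inner st ++ outer st) v)].

(* The codes are larger than any vertex that a script branches on. *)
Definition contradictory (c : nat) (st : state) : bool :=
  let adj := table (inner st ++ outer st) (order st) in
  match c with
  | 20 => embeds adj predT spider (order st) [::]
  | 21 => embeds adj predT K33_subdivided (order st) [::]
  | 22 => embeds adj predT petersen_minus (order st) [::]
  | 23 => embeds adj
      (fun s => 12 < count (fun p => nth 0 s p.1 \in adj (nth 0 s p.2)) pairs9)
      cycle9 (order st) [::]
  | 24 => [&& inner st != [::], all_saturated st & colours (rev (inner st)) [::]]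
  | _ => false
  end.

(* [cs] is the script of the case tree in prefix order: at each case without a
   clash it names a contradiction or a vertex whose next edge is branched on.
   The result is the unused part of the script. *)
Fixpoint refute (d : nat) (st : state) (cs : seq nat) : option (seq nat) :=
  if clash st then Some cs else
  if cs is c :: cs' then
    if contradictory c st then Some cs' else
    if d is d'.+1 then
      if size (nbs (inner st) c) \in [:: 1; 2] then
        foldl (fun o st' => obind (refute d' st') o) (Some cs') (children st c)
      else None
    else None
  else None.

Lemma mem_nbs E v w : w \in nbs E v -> (v, w) \in E \/ (w, v) \in E.
Proof.
rewrite mem_undup => /mapP[[a b]]; rewrite mem_filter /= => /andP[/orP[]/eqP-> eE].
  by rewrite eqxx => ->; left.
by case: eqP => [a_v ->|_ ->]; [left; rewrite -{1}a_v|right].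
Qed.

Lemma nbs_mem E v w : (v, w) \in E \/ (w, v) \in E -> v != w -> w \in nbs E v.
Proof.
move=> vw nvw; rewrite mem_undup; apply/mapP.
case: vw => e_E.
  by exists (v, w); rewrite ?mem_filter /= eqxx.
by exists (w, v); rewrite ?mem_filter /= ?eqxx ?orbT // eq_sym (negPf nvw).
Qed.

Lemma nbs_uniq E v : uniq (nbs E v).
Proof. exact: undup_uniq. Qed.

Lemma tableE E n v : table E n v = if v < n then nbs E v else [::].
Proof.
rewrite /table; case: ltnP => lt_vn; last by rewrite nth_default // size_map size_iota.
by rewrite (nth_map 0) ?size_iota // nth_iota.
Qed.

Lemma mem_table E n v w : w \in table E n v -> (v < n) && (w \in nbs E v).
Proof. by rewrite tableE; case: ifP. Qed.

Lemma embedsP adj fin P n s : (forall v, {subset adj v <= gtn n}) ->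
    {subset s <= gtn n} -> uniq s -> embeds adj fin P n s ->
  exists t, [/\ uniq t, {subset t <= gtn n},
    size t = size s + size P /\ take (size s) t = s, fin t &
    forall i j, i < size P -> j < size s + i -> j \in nth [::] P i ->
      nth 0 t (size s + i) \in adj (nth 0 t j)].
Proof.
move=> adj_n; elim: P s => [|js P IHP] s s_n s_uniq /=.
  by move=> fin_s; exists s; rewrite addn0 take_size.
case/hasP=> x x_js /and3P[x_s x_adj x_emb].
have x_n : x < n.
  case: js x_js x_adj => [|j js] /=; first by rewrite mem_iota.
  by move=> /adj_n.
have sx_n : {subset rcons s x <= gtn n}.
  by move=> y; rewrite mem_rcons inE => /predU1P[->|/s_n].
have sx_uniq : uniq (rcons s x) by rewrite rcons_uniq x_s.
have [t [t_uniq t_n [sz_t take_t] fin_t adj_t]] := IHP _ sx_n sx_uniq x_emb.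
rewrite size_rcons in sz_t take_t adj_t.
have take_s : take (size s) t = s.
  by rewrite -(@take_takel _ _ (size s).+1) // take_t -cats1 take_size_cat.
have nth_s j : j < size s -> nth 0 t j = nth 0 s j.
  by move=> lt_js; rewrite -take_s nth_take.
exists t; split=> //; first by split; rewrite // sz_t addSnnS.
case=> [|i] j; rewrite ?ltnS ?addn0.
  move=> _ lt_js j_js; rewrite (nth_s j) //.
  have ->: nth 0 t (size s) = x.
    by rewrite -(@nth_take (size s).+1) // take_t nth_rcons ltnn eqxx.
  exact: (allP x_adj).
by move=> lt_i lt_j; rewrite addnS -addSn in lt_j *; apply: adj_t.
Qed.

Definition proper_list (T : eqType) : seq ((T * T) * nat) -> bool :=
  pairwise (fun d e => touch d.1 e.1 ==> (d.2 != e.2)).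

Lemma coloursP E D : colours E D -> proper_list D -> all (fun d => d.2 < 3) D ->
  exists D', [/\ map fst D' = rev E ++ map fst D, proper_list D'
               & all (fun d => d.2 < 3) D'].
Proof.
elim: E D => [|e E IHE] D; first by exists D.
move=> colD prD D3.
have /hasP[c] : has (fun c => all (fun d => touch e d.1 ==> (c != d.2)) D
                              && colours E ((e, c) :: D)) (iota 0 3) := colD.
rewrite mem_iota => /= c3 /andP[c_D colE].
have prD1 : proper_list ((e, c) :: D) by rewrite /proper_list /= c_D.
have D13 : all (fun d => d.2 < 3) ((e, c) :: D) by rewrite /= c3.
have [D' [D'E prD' D'3]] := IHE _ colE prD1 D13.
by exists D'; rewrite D'E rev_cons cat_rcons.
Qed.

Fixpoint any (T : Type) (P : T -> Prop) (s : seq T) : Prop :=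
  if s is x :: s' then P x \/ any P s' else False.

Lemma some_cat (T : Type) (P : T -> Prop) s1 s2 :
  any P s1 \/ any P s2 -> any P (s1 ++ s2).
Proof. by elim: s1 => [|x s1 IHs] /=; intuition. Qed.

Lemma some_map (T : eqType) (S : Type) (P : S -> Prop) (F : T -> S) s x :
  x \in s -> P (F x) -> any P (map F s).
Proof.
by elim: s => //= y s IHs; rewrite inE => /predU1P[<-|xs] PFx; [left|right; apply: IHs].
Qed.

(** * Soundness of the refutation procedure *)

Section Host.

(** In the application [h] is adjacency in the root graph and [k] adjacency along critical edges. *)
Variables (V : finType) (h k : rel V).

Definition occurs (P : seq (seq nat)) (f : nat -> V) : Prop :=
  {in gtn (size P) &, injective f} /\
  (forall i j, i < size P -> j < i -> j \in nth [::] P i -> h (f i) (f j)).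

Definition realizes (st : state) (f : nat -> V) : Prop :=
  [/\ {in gtn (order st) &, injective f},
    {in inner st, forall e, [&& e.1 < order st, e.2 < order st & k (f e.1) (f e.2)]},
    {in outer st, forall e,
      [&& e.1 < order st, e.2 < order st, h (f e.1) (f e.2) & ~~ k (f e.1) (f e.2)]},
    {in twos st, forall v, (v < order st) && (#|[set w | k (f v) w]| == 2)} &
    {in outs st, forall v, (v < order st) && ([set w | k (f v) w] == set0)}].

Definition lists (D : seq ((V * V) * nat)) (u v : V) : bool :=
  has (fun d => (d.1 == (u, v)) || (d.1 == (v, u))) D.

Hypotheses (h_sym : symmetric h) (h_irr : irreflexive h).
Hypotheses (k_sym : symmetric k) (k_h : subrel k h).
Hypothesis h_deg : forall v, #|[set w | h v w]| <= 3.
Hypothesis h_tri : forall a b c, h a b -> h b c -> h c a -> False.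
Hypothesis k_deg : forall u v, k u v -> 1 < #|[set w | k u w]|.
Hypothesis k_two : forall u v, #|[set w | k u w]| = 2 -> #|[set w | k v w]| = 2 ->
  u != v -> k u v \/ (exists2 w, k u w & k w v) -> False.
(** [D] is a properly 3-coloured set of critical edges that is complete at all its vertices except
    perhaps [c], where two of at most three edges are listed. Such a part hangs on at most one edge,
    which criticality forbids. *)
Hypothesis k_closed : forall D c, D != [::] -> proper_list D ->
  {in D, forall d, k d.1.1 d.1.2 && (d.2 < 3)} ->
  (forall u v w, lists D u v -> u != c -> k u w -> lists D u w) ->
  (forall w, k c w -> lists D c w) \/
    (exists a b, [/\ a != b, lists D c a & lists D c b]) ->
  False.
Hypothesis no_spider : forall f, ~ occurs spider f.
Hypothesis no_K33 : forall f, ~ occurs K33_subdivided f.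
Hypothesis no_petersen : forall f, ~ occurs petersen_minus f.
Hypothesis no_cycle9 : forall f, occurs cycle9 f ->
  12 < count (fun p => h (f p.1) (f p.2)) pairs9 -> False.

Section Realized.

Variables (st : state) (f : nat -> V).
Hypothesis fP : realizes st f.

Lemma inner_nbs v w : w \in nbs (inner st) v ->
  [&& v < order st, w < order st & k (f v) (f w)].
Proof.
case: fP => _ inP _ _ _ /mem_nbs[] /inP /and3P[-> -> //].
by rewrite k_sym.
Qed.

Lemma outer_nbs v w : w \in nbs (outer st) v ->
  [&& v < order st, w < order st, h (f v) (f w) & ~~ k (f v) (f w)].
Proof.
case: fP => _ _ outP _ _ /mem_nbs[] /outP /and4P[-> -> hvw kvw] /=.
  by rewrite hvw kvw.
by rewrite h_sym k_sym hvw kvw.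
Qed.

Lemma inj_mem v w : v < order st -> w < order st -> (f v == f w) = (v == w).
Proof. by case: fP => f_inj _ _ _ _ lt_v lt_w; apply: (inj_in_eq f_inj). Qed.

Lemma image_nbs (s : seq nat) (A : {set V}) : uniq s ->
    {in s, forall w, (w < order st) && (f w \in A)} ->
  [set x in map f s] \subset A /\ #|[set x in map f s]| = size s.
Proof.
move=> s_uniq sA; split.
  by apply/subsetP=> x; rewrite inE => /mapP[w /sA/andP[_ fwA] ->].
rewrite cardsE (card_uniqP _) ?size_map // map_inj_in_uniq // => v w.
by move=> /sA/andP[lt_v _] /sA/andP[lt_w _] /eqP; rewrite inj_mem // => /eqP.
Qed.

Lemma inner_size v :
  size (nbs (inner st) v) <= #|[set w | k (f v) w]| ?= iff
    ([set x in map f (nbs (inner st) v)] == [set w | k (f v) w]).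
Proof.
have [|sub <-] := @image_nbs (nbs (inner st) v) [set w | k (f v) w] (nbs_uniq _ _).
  by move=> w /inner_nbs/and3P[_ -> kvw]; rewrite inE.
exact: subset_leqif_cards.
Qed.

Lemma outer_size v : #|[set w | k (f v) w]| + size (nbs (outer st) v) <= 3.
Proof.
have [|sub <-] := @image_nbs (nbs (outer st) v) [set w | h (f v) w && ~~ k (f v) w]
  (nbs_uniq _ _).
  by move=> w /outer_nbs/and4P[_ -> hvw kvw]; rewrite inE hvw.
apply: leq_trans (h_deg (f v)).
rewrite -cardsUI [X in _ + X]eq_card0 ?addn0 => [|w].
  apply: subset_leq_card; apply/subsetP=> w; rewrite in_setU.
  case/orP=> [|/(subsetP sub)]; first by rewrite !inE => /k_h.
  by rewrite !inE => /andP[].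
rewrite in_setI; apply/negP=> /andP[kvw /(subsetP sub)].
by rewrite inE in kvw; rewrite inE kvw andbF.
Qed.

Lemma twos_card v : v \in twos st -> #|[set w | k (f v) w]| = 2.
Proof. by case: fP => _ _ _ twP _ /twP/andP[_ /eqP]. Qed.

Lemma two_card v : nbs (inner st) v != [::] -> nbs (outer st) v != [::] ->
  #|[set w | k (f v) w]| = 2.
Proof.
move=> Iv Ov; case defI: (nbs _ _) Iv => [//|w I] _.
have : w \in nbs (inner st) v by rewrite defI mem_head.
case/inner_nbs/and3P=> _ _ /k_deg; move: (outer_size v).
case: (nbs _ _) Ov => //= _ o _; lia.
Qed.

Lemma clash_false : ~~ clash st.
Proof.
apply/negP=> /hasP[v]; rewrite mem_iota add0n => /andP[_ lt_v].
set n := order st; set inn := table _ n; set out := table _ n.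
have inn_k u w : w \in inn u -> [&& u < n, w < n & k (f u) (f w)].
  by move=> /mem_table/andP[_ /inner_nbs].
have h_nb u w : w \in inn u ++ out u -> h (f u) (f w).
  rewrite mem_cat => /orP[/inn_k/and3P[_ _ /k_h] //|].
  by case/mem_table/andP=> _ /outer_nbs/and4P[].
pose two u := (u \in twos st) || (inn u != [::]) && (out u != [::]).
have two2 u : two u -> #|[set w | k (f u) w]| = 2.
  case/orP=> [/twos_card //|]; rewrite /inn /out !tableE; case: ifP => // _.
  by case/andP=> *; apply: two_card.
have innE: inn v = nbs (inner st) v by rewrite /inn tableE lt_v.
have outE: out v = nbs (outer st) v by rewrite /out tableE lt_v.
have le_inn := inner_size v; have le_out := outer_size v.
rewrite -/(two v) innE outE in le_inn le_out *.
rewrite -innE -outE in le_inn le_out *.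
have inn1 : inn v != [::] -> 1 < #|[set w | k (f v) w]|.
  case defI: (inn v) => [//|w I] _.
  by have /inn_k/and3P[_ _ /k_deg] : w \in inn v by rewrite defI mem_head.
case/or4P.
- by rewrite size_cat ltnNge (leq_trans _ le_out) // leq_add2r le_inn.
- by case/andP=> /inn1; lia.
- case/andP=> /inn1; case: fP => _ _ _ _ outP lt1 /outP/andP[_ /eqP k0].
  by rewrite k0 cards0 in lt1.
case/or3P.
- case/andP=> /twos_card k2; rewrite ltnNge; have := le_inn.1; rewrite k2.
  by move=> ->.
- case/hasP=> a av /hasP[b ba bv].
  by apply: (h_tri (h_nb _ _ av) (h_nb _ _ ba)); rewrite h_sym h_nb.
case/andP=> /two2 v2 /hasP[a av].
have /and3P[_ lt_a kva] := inn_k _ _ av.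
case/orP=> [/two2 a2|/hasP[b ba /andP[nbv /two2 b2]]].
  apply: (k_two v2 a2); last by left.
  by apply/eqP=> E; have := k_h kva; rewrite E h_irr.
have /and3P[_ lt_b kab] := inn_k _ _ ba.
apply: (k_two v2 b2); last by right; exists (f a).
by rewrite inj_mem // eq_sym.
Qed.

Lemma nb_h n v w : w \in table (inner st ++ outer st) n v ->
  (w < order st) && h (f v) (f w).
Proof.
case/mem_table/andP=> _ /mem_nbs; rewrite !mem_cat => vw.
have: w \in nbs (inner st) v \/ w \in nbs (outer st) v.
  case: (eqVneq v w) vw => [<-|nvw] vw.
    case: fP => _ inP outP _ _.
    have hvv : h (f v) (f v); last by rewrite h_irr in hvv.
    by case: vw => /orP[/inP/and3P[_ _ /k_h]|/outP/and4P[]].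
  case: vw => /orP[] vw; [left|right|left|right]; apply: nbs_mem => //; by [left|right].
case=> [/inner_nbs/and3P[_ -> /k_h] //|/outer_nbs/and4P[_ -> -> //]].
Qed.

Lemma embeds_occurs fin P :
    embeds (table (inner st ++ outer st) (order st)) fin P (order st) [::] ->
  exists2 t, occurs P (f \o nth 0 t) & fin t /\ size t = size P.
Proof.
set adj := table _ _ => emb.
have adj_n v : {subset adj v <= gtn (order st)} by move=> w /nb_h/andP[].
have [//|//|t [t_uniq t_n [sz_t _] fin_t adj_t]] := embedsP adj_n _ _ emb.
exists t => //; split=> [i j lt_i lt_j|i j lt_i lt_ji j_i].
  move=> /eqP; rewrite /= inj_mem ?nth_uniq ?sz_t //; first by move/eqP.
    by apply: t_n; rewrite mem_nth ?sz_t.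
  by apply: t_n; rewrite mem_nth ?sz_t.
have := adj_t i j lt_i lt_ji j_i; rewrite h_sym /=.
by case/nb_h/andP.
Qed.

Definition host_edge (d : (nat * nat) * nat) : (V * V) * nat := ((f d.1.1, f d.1.2), d.2).

Lemma image_lists D v u : map fst D =i inner st ->
  u \in nbs (inner st) v -> lists (map host_edge D) (f v) (f u).
Proof.
move=> DE /mem_nbs[]; rewrite -DE => /mapP[d dD E]; apply/hasP;
  by exists (host_edge d); rewrite ?map_f // /host_edge -E !eqxx ?orbT.
Qed.

Lemma saturated_lists D v w : map fst D =i inner st -> saturated st v ->
  nbs (inner st) v != [::] -> k (f v) w -> lists (map host_edge D) (f v) w.
Proof.
move=> DE sat_v Iv kvw.
suff : #|[set w | k (f v) w]| <= size (nbs (inner st) v).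
  rewrite (geq_leqif (inner_size v)) => /eqP E.
  have: w \in [set w | k (f v) w] by rewrite inE.
  by rewrite -E inE => /mapP[u uI ->]; apply: image_lists.
have := outer_size v; case/or3P: sat_v.
- by rewrite size_eq0 (negPf Iv).
- by move=> /eqP->; lia.
by case/andP=> /eqP-> /orP[/twos_card->|/(two_card Iv)->].
Qed.

Lemma contradictory_false c : ~~ contradictory c st.
Proof.
have occ P : (forall g, ~ occurs P g) ->
    ~~ embeds (table (inner st ++ outer st) (order st)) predT P (order st) [::].
  by move=> noP; apply/negP=> /embeds_occurs[t /noP].
(* The codes start at 20; smaller numbers only name vertices. *)
do 20![case: c => [//|c]].
case: c => [|[|[|[|[|//]]]]]; try exact: occ.
  apply/negP=> /embeds_occurs[t occ_t [cnt _]]; apply: (no_cycle9 occ_t).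
  apply: leq_trans cnt _; apply: sub_count => p /=.
  by case/nb_h/andP; rewrite h_sym.
apply/negP=> /and3P[I0 cl /coloursP[//|//|D [DE prD D3]]].
have {}DE : map fst D =i inner st by move=> e; rewrite DE cats0 revK.
case: (fP) => _ inP _ _ _.
have D'P : {in map host_edge D, forall d, k d.1.1 d.1.2 && (d.2 < 3)}.
  move=> _ /mapP[d dD ->] /=; rewrite (allP D3) // andbT.
  by have /inP/and3P[] : d.1 \in inner st by rewrite -DE map_f.
have endP u w : lists (map host_edge D) u w ->
    exists v, [/\ v < order st, nbs (inner st) v != [::] & u = f v].
  case/hasP=> _ /mapP[[[a b] c] abc ->] /=.
  have abI : (a, b) \in inner st by rewrite -DE; apply/mapP; exists (a, b, c).
  have /and3P[/= lt_a lt_b kab] := inP _ abI.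
  have nab : a != b by apply/eqP=> E; have := k_h kab; rewrite E h_irr.
  rewrite !xpair_eqE => /orP[]/andP[/eqP E /eqP E'].
    exists a; split=> //; have: b \in nbs (inner st) a by apply: nbs_mem => //; left.
    by case: (nbs _ _).
  exists b; split=> //; have: a \in nbs (inner st) b.
    by apply: nbs_mem; rewrite 1?eq_sym //; right.
  by case: (nbs _ _).
have prD' : proper_list (map host_edge D).
  rewrite /proper_list pairwise_map; apply: (@sub_in_pairwise _ (mem D)) prD; last exact/allP.
  move=> d e dD eD /implyP ne; apply/implyP=> td; apply: ne.
  have /inP/and3P[d1 d2 _] : d.1 \in inner st by rewrite -DE map_f.
  have /inP/and3P[e1 e2 _] : e.1 \in inner st by rewrite -DE map_f.
  by move: td; rewrite /touch /= !inj_mem.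
have D0 : map host_edge D != [::].
  case: (D) DE => [/=|//]; case: (inner st) I0 => // e I _ /(_ e).
  by rewrite mem_head.
have satP v : v < order st -> ~~ saturated st v ->
   size (nbs (inner st) v) = 2 /\ forall u, u < order st -> ~~ saturated st u -> u = v.
  move=> lt_v nv; move: cl; rewrite /all_saturated.
  have mem_us u : (u \in [seq v <- iota 0 (order st) | ~~ saturated st v])
     = ~~ saturated st u && (u < order st).
    by rewrite mem_filter mem_iota.
  case: [seq _ <- _ | _] mem_us => [/(_ v)|v0 us mem_us].
    by rewrite nv lt_v.
  case/andP=> /eqP us0 /eqP sz0; rewrite us0 in mem_us.
  have uE u : u < order st -> ~~ saturated st u -> u = v0.
    by move=> lt_u nu; have := mem_us u; rewrite nu lt_u inE => /eqP.
  rewrite (uE v) //; split=> // u; exact: uE.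
have unsat_or : (exists2 v, v < order st & ~~ saturated st v) \/
    (forall v, v < order st -> saturated st v).
  case: (boolP (has (fun v => ~~ saturated st v) (iota 0 (order st)))) => [/hasP|/hasPn sat].
    by case=> v; rewrite mem_iota => lt_v nv; left; exists v.
  by right=> v lt_v; have := sat v; rewrite mem_iota negbK; apply.
case: unsat_or => [[v lt_v nv]|sat].
  have [sz2 uniq_v] := satP v lt_v nv.
  apply: (k_closed (c := f v) D0 prD' D'P).
    move=> u w x /endP[a [lt_a Ia ->]] nav kx.
    apply: saturated_lists => //; apply: contraR nav => na.
    by rewrite (uniq_v a).
  (* The two known edges at the exceptional vertex give the second alternative of [k_closed]. *)
  right; move: sz2 (@nbs_uniq (inner st) v) (@image_lists D v) (@inner_nbs v).
  case: (nbs _ _) => [|a [|b []]] //= _ /andP[nab _] im lt_in.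
  exists (f a), (f b); split; rewrite ?im ?inE ?eqxx ?orbT //.
  rewrite inj_mem //; first by rewrite inE in nab.
    by case/and3P: (lt_in a (mem_head _ _)).
  by case/and3P: (lt_in b (mem_last a [:: b])).
(* With everything saturated, any end of a listed edge can play the part of [c]. *)
have [e eD] : exists e, e \in map host_edge D.
  by case: (map host_edge D) D0 => [//|e s] _; exists e; rewrite mem_head.
have list_e : lists (map host_edge D) e.1.1 e.1.2.
  by apply/hasP; exists e => //; rewrite -surjective_pairing eqxx.
have [v [lt_v Iv vE]] := endP _ _ list_e.
apply: (k_closed (c := f v) D0 prD' D'P).
  by move=> u w x /endP[a [lt_a Ia ->]] _; apply: saturated_lists => //; apply: sat.
by left=> w; apply: saturated_lists => //; apply: sat.
Qed.

Lemma children_realized v : size (nbs (inner st) v) \in [:: 1; 2] ->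
  any (fun st' => exists g, realizes st' g) (children st v).
Proof.
move=> szv; pose n := order st.
have lt_v : v < n.
  case defI: (nbs (inner st) v) szv => [//|w I] _.
  by have /inner_nbs/and3P[] : w \in nbs (inner st) v by rewrite defI mem_head.
case: (fP) => f_inj inP outP twP nkP; rewrite /children.
case: (boolP (size (nbs (inner st) v) == #|[set w | k (f v) w]|)) => [/eqP szE|ne_sz].
  (* All critical edges at [f v] are known here, and by minimum degree there cannot be just one; the
     first child is realized. *)
  have k2 : #|[set w | k (f v) w]| = 2.
    move: szv; rewrite !inE => /orP[/eqP sz1|/eqP sz2]; last by rewrite -szE.
    case defI: (nbs (inner st) v) (sz1) => [//|w I] _.
    have /inner_nbs/and3P[_ _ /k_deg] : w \in nbs (inner st) v by rewrite defI mem_head.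
    by rewrite -szE sz1.
  rewrite szE k2 eqxx; left; exists f; split=> // u; rewrite inE => /predU1P[->|/twP //].
  by rewrite lt_v k2.
have [w kvw wI] : exists2 w, k (f v) w & w \notin map f (nbs (inner st) v).
  move: ne_sz; rewrite (inner_size v).2 eqEsubset => /nandP[/negP[]|/subsetPn[w]].
    apply/subsetP=> x; rewrite inE => /mapP[u /inner_nbs/and3P[_ _ kvu] ->].
    by rewrite inE.
  by rewrite !inE => *; exists w.
have joinP g u : u <= n -> g u = w -> {in gtn n, g =1 f} ->
    {in gtn (maxn n u.+1) &, injective g} -> realizes (join st v u) g.
  move=> le_u gu gf g_inj; have lt_max x : x < n -> x < maxn n u.+1.
    by move=> lt_x; rewrite leq_max lt_x.
  split=> //=.
  - move=> e; rewrite inE => /predU1P[->|/inP/and3P[e1 e2 ke]] /=.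
      by rewrite lt_max // leq_max leqnn orbT gu gf.
    by rewrite !lt_max //= !gf.
  - by move=> e /outP/and4P[e1 e2 he ke]; rewrite !lt_max //= !gf // he.
  - by move=> x /twP/andP[lt_x kx]; rewrite lt_max //= gf.
  by move=> x /nkP/andP[lt_x kx]; rewrite lt_max //= gf.
apply: some_cat; right.
have nvw : f v != w by apply/eqP=> E; have := k_h kvw; rewrite E h_irr.
case: (boolP (has (fun u => f u == w) (iota 0 n))) => [/hasP[u]|/hasPn w_new].
  rewrite mem_iota => lt_u /eqP fu; apply: (@some_map _ _ _ _ _ u).
    rewrite mem_filter mem_iota /= add0n ltnS (ltnW lt_u) andbT.
    apply/andP; split; first by apply: contraNN nvw => /eqP <-; rewrite fu.
    apply/negP=> /mem_nbs; rewrite !mem_cat => uv.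
    have nuv : v != u by apply: contraNN nvw => /eqP ->; rewrite fu.
    have {}uv : u \in nbs (inner st) v \/ u \in nbs (outer st) v.
      by case: uv => /orP[] uv; [left|right|left|right]; apply: nbs_mem => //; by [left|right].
    case: uv => [uI|/outer_nbs/and4P[_ _ _]]; last by rewrite fu kvw.
    by rewrite -fu map_f in wI.
  exists f; apply: joinP => //; first exact: ltnW.
  by rewrite (maxn_idPl lt_u).
pose g i := if i == n then w else f i.
have gf : {in gtn n, g =1 f} by move=> i; rewrite /g inE; case: ltngtP.
have gn : g n = w by rewrite /g eqxx.
have fw i : i < n -> (f i == w) = false.
  by move=> lt_i; apply/negbTE/w_new; rewrite mem_iota.
apply: (@some_map _ _ _ _ _ n).
  rewrite mem_filter mem_iota /= add0n leqnn andbT; apply/andP; split.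
    by rewrite neq_ltn lt_v orbT.
  apply/negP=> /mem_nbs; rewrite !mem_cat.
  by case=> /orP[/inP/and3P[]|/outP/and4P[]] /=; rewrite ltnn.
exists g; apply: joinP => //.
rewrite (maxn_idPr (leqnSn n)) => i j; rewrite !inE !ltnS /g.
have [-> _|ne_i le_i] := eqVneq i n; have [-> _|ne_j le_j] := eqVneq j n => //.
- by move/eqP; rewrite eq_sym fw // ltn_neqAle ne_j.
- by move/eqP; rewrite fw // ltn_neqAle ne_i.
by apply: f_inj; rewrite !inE ltn_neqAle ?ne_i ?ne_j.
Qed.

End Realized.

Theorem refute_sound d st cs : refute d st cs -> ~ exists f, realizes st f.
Proof.
elim: d st cs => [|d IHd] st cs /= + [f fP].
  rewrite (negPf (clash_false fP)); case: cs => // c cs.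
  by rewrite (negPf (contradictory_false fP c)).
rewrite (negPf (clash_false fP)); case: cs => // c cs.
rewrite (negPf (contradictory_false fP c)); case: ifP => // szc.
have := children_realized fP szc.
(* The fold stays at [None] once it gets there, so its success means that every child was refuted
   with some part of the script. *)
elim: (children st c) (Some cs) => [//|st' sts IHs] o /= [] real.
  case def_o: (obind (refute d st') o) => [cs'|].
    case: o def_o => //= cs0 def_o.
    by case: (IHd st' cs0) => //; rewrite def_o.
  by elim: (sts).
exact: IHs.
Qed.

End Host.

(** * The starting configurations and their case trees *)

(* The edge 04 is critical, and the path 0123 leaves the critical part at 0. *)
Definition exit_state : state :=
  State 5 [:: (0, 4)] [:: (0, 1); (1, 2); (2, 3)] [::] [:: 1; 2; 3].

Definition exit_script : seq nat :=
  [:: 0; 4; 4; 6; 6; 5; 7; 24; 20; 7; 7; 20; 20; 20; 20; 6; 5; 7; 24; 20; 7; 7; 20;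
  20; 20; 20; 8; 8; 20; 20; 5; 20; 20; 20; 10; 20; 20; 20; 20; 5; 5; 20; 20; 20; 20;
  20; 7; 20; 20; 20; 20; 20; 20; 11; 20; 20; 20; 20; 20].

(** The number 20 only bounds the depth of the case tree. *)
Lemma exit_refuted : refute 20 exit_state exit_script.
Proof. by lazy. Qed.

Definition cycle5 : seq (nat * nat) := [:: (0, 1); (1, 2); (2, 3); (3, 4); (4, 0)].

Definition cycle_state (p : bitseq) : state :=
  State 5 (mask p cycle5) (mask (map negb p) cycle5) [::] [::].

Definition script_three : seq nat :=
  [:: 0; 1; 2; 3; 5; 24; 6; 24; 7; 7; 20; 20; 5; 6; 24; 7; 7; 20; 20; 6; 24; 8; 6; 20;
  20; 6; 6; 7; 20; 20; 6; 7; 20; 7; 20; 20; 20; 7; 20; 20; 20; 20; 3; 5; 5; 24; 7; 7;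
  20; 20; 5; 24; 7; 8; 20; 20; 8; 5; 7; 20; 20; 5; 7; 20; 20; 20; 5; 6; 5; 7; 24; 20;
  8; 20; 20; 20; 5; 7; 24; 20; 7; 20; 20; 20; 20; 5; 6; 7; 24; 20; 20; 6; 6; 24; 20;
  22; 20; 6; 6; 20; 20; 20; 20; 20; 20; 5; 6; 7; 24; 20; 20; 6; 6; 24; 20; 22; 20; 9;
  20; 20; 20; 9; 20; 8; 20; 20; 20; 20; 20; 9; 20; 20; 20; 20].

Definition script_four : seq nat :=
  [:: 0; 1; 2; 3; 4; 5; 21; 6; 24; 7; 24; 20; 7; 7; 24; 20; 6; 24; 24; 20; 20; 4; 5;
  21; 6; 24; 7; 24; 20; 7; 7; 24; 20; 6; 24; 24; 20; 20; 5; 6; 8; 24; 20; 7; 24; 20;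
  7; 20; 7; 20; 20; 20; 8; 6; 24; 20; 6; 24; 20; 20; 7; 6; 24; 20; 6; 24; 20; 20; 6;
  20; 20; 20; 7; 20; 20; 20; 20; 20; 3; 4; 5; 21; 6; 24; 7; 24; 20; 7; 7; 24; 20; 6;
  24; 22; 20; 20; 5; 6; 24; 7; 24; 20; 21; 6; 6; 24; 20; 6; 24; 20; 20; 5; 7; 8; 24;
  20; 6; 24; 24; 20; 20; 6; 6; 24; 20; 6; 24; 20; 20; 6; 6; 24; 20; 7; 24; 20; 7; 20;
  20; 20; 8; 20; 20; 20; 20; 20; 8; 20; 20; 20; 6; 20; 20; 20; 20; 20; 4; 6; 5; 24; 7;
  24; 20; 21; 5; 5; 24; 20; 5; 24; 20; 20; 5; 8; 7; 24; 20; 5; 24; 24; 20; 20; 5; 8;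
  24; 20; 6; 24; 24; 20; 8; 20; 20; 20; 20; 5; 7; 24; 20; 6; 24; 24; 20; 20; 8; 20;
  20; 20; 20; 9; 20; 20; 20; 20; 20; 4; 5; 5; 8; 24; 20; 7; 24; 20; 7; 20; 8; 20; 20;
  20; 20; 5; 8; 24; 20; 6; 24; 24; 20; 8; 20; 20; 20; 20; 5; 7; 24; 20; 6; 24; 24; 20;
  7; 20; 20; 20; 20; 9; 20; 8; 20; 20; 20; 20; 20; 7; 20; 20; 20; 20; 20; 20; 5; 5; 6;
  24; 20; 6; 24; 20; 20; 6; 6; 24; 20; 5; 24; 24; 20; 20; 5; 6; 24; 20; 6; 24; 20; 6;
  20; 20; 20; 20; 6; 20; 20; 20; 20; 9; 20; 20; 20; 20; 20; 5; 5; 20; 9; 20; 20; 20;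
  20; 6; 8; 20; 20; 20; 7; 20; 20; 20; 20; 20; 6; 20; 20; 20; 20; 20; 9; 20; 20; 20;
  20; 20; 5; 6; 8; 20; 20; 20; 7; 20; 20; 20; 20; 6; 20; 20; 20; 20; 20; 20; 10; 20;
  6; 20; 20; 20; 20; 20; 20; 6; 20; 20; 20; 20; 20; 20; 20; 20].

Definition script_five : seq nat :=
  [:: 0; 1; 2; 3; 4; 5; 21; 6; 24; 7; 7; 24; 20; 20; 5; 7; 24; 8; 7; 20; 20; 6; 24; 8;
  6; 24; 20; 20; 6; 7; 6; 24; 20; 20; 7; 7; 20; 6; 24; 20; 20; 7; 20; 20; 20; 20; 4;
  5; 7; 24; 8; 7; 24; 20; 20; 6; 24; 8; 6; 24; 20; 20; 6; 6; 7; 24; 20; 7; 24; 20; 20;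
  7; 7; 24; 20; 6; 24; 20; 20; 7; 20; 20; 20; 8; 20; 20; 20; 20; 20; 5; 5; 24; 7; 7;
  24; 20; 20; 5; 24; 8; 7; 24; 20; 20; 8; 5; 7; 24; 20; 20; 5; 7; 24; 20; 20; 20; 5;
  5; 6; 8; 24; 20; 7; 24; 23; 20; 20; 6; 7; 24; 20; 7; 24; 23; 20; 20; 7; 8; 20; 20;
  20; 20; 8; 20; 20; 20; 20; 20; 5; 6; 8; 24; 20; 7; 24; 23; 20; 20; 6; 6; 24; 22; 20;
  22; 20; 6; 8; 20; 20; 20; 20; 20; 20; 5; 6; 7; 24; 20; 7; 24; 23; 20; 20; 6; 6; 24;
  22; 20; 22; 20; 9; 20; 20; 20; 9; 20; 8; 20; 20; 20; 20; 20; 9; 6; 7; 20; 20; 20;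
  20; 7; 20; 20; 20; 20; 20; 20; 20; 20; 1; 4; 3; 2; 5; 21; 6; 24; 7; 7; 24; 20; 20;
  5; 7; 24; 8; 7; 20; 20; 6; 24; 8; 6; 24; 20; 20; 6; 7; 6; 24; 20; 20; 7; 7; 20; 6;
  24; 20; 20; 7; 20; 20; 20; 20; 2; 5; 7; 24; 8; 7; 24; 20; 20; 6; 24; 8; 6; 24; 20;
  20; 6; 6; 7; 24; 20; 7; 24; 20; 20; 7; 7; 24; 20; 6; 24; 20; 20; 7; 20; 20; 20; 8;
  20; 20; 20; 20; 20; 5; 5; 24; 7; 7; 24; 20; 20; 5; 24; 8; 7; 24; 20; 20; 8; 5; 7;
  24; 20; 20; 5; 7; 24; 20; 20; 20; 5; 5; 6; 8; 24; 20; 7; 24; 23; 20; 20; 6; 7; 24;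
  20; 7; 24; 23; 20; 20; 7; 8; 20; 20; 20; 20; 8; 20; 20; 20; 20; 20; 5; 6; 8; 24; 20;
  7; 24; 23; 20; 20; 6; 6; 24; 22; 20; 22; 20; 6; 8; 20; 20; 20; 20; 20; 20; 5; 6; 7;
  24; 20; 7; 24; 23; 20; 20; 6; 6; 24; 22; 20; 22; 20; 9; 20; 20; 20; 9; 20; 8; 20;
  20; 20; 20; 20; 9; 6; 7; 20; 20; 20; 20; 7; 20; 20; 20; 20; 20; 20; 20; 20; 2; 4; 3;
  5; 21; 6; 24; 7; 7; 24; 20; 20; 5; 7; 24; 8; 7; 20; 20; 6; 24; 24; 7; 5; 24; 20; 20;
  7; 7; 8; 20; 20; 8; 5; 24; 20; 20; 7; 5; 24; 20; 20; 20; 3; 5; 6; 24; 7; 7; 24; 20;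
  20; 6; 24; 8; 6; 20; 20; 6; 6; 7; 24; 20; 20; 6; 7; 24; 20; 20; 7; 20; 20; 20; 20;
  5; 7; 24; 8; 7; 24; 20; 20; 6; 24; 24; 5; 7; 24; 20; 7; 24; 20; 20; 8; 7; 7; 24; 20;
  5; 24; 20; 20; 5; 6; 24; 24; 20; 7; 24; 20; 6; 20; 20; 20; 20; 6; 7; 20; 20; 20; 20;
  7; 20; 20; 20; 7; 20; 20; 20; 20; 20; 5; 5; 6; 8; 24; 20; 7; 24; 20; 7; 20; 8; 20;
  20; 20; 20; 6; 7; 24; 23; 20; 8; 20; 20; 20; 6; 7; 24; 23; 20; 7; 20; 20; 20; 20; 5;
  6; 6; 24; 8; 20; 20; 6; 24; 20; 8; 20; 20; 20; 7; 20; 20; 20; 20; 20; 6; 7; 24; 23;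
  20; 8; 20; 20; 20; 7; 6; 24; 8; 20; 20; 20; 6; 22; 20; 20; 6; 20; 20; 20; 8; 20; 20;
  20; 20; 20; 7; 7; 6; 24; 8; 20; 20; 20; 6; 22; 20; 20; 6; 7; 24; 23; 20; 22; 20; 6;
  6; 23; 20; 5; 24; 23; 20; 20; 20; 6; 20; 20; 9; 20; 20; 20; 20; 20; 9; 20; 20; 20;
  20; 20; 3; 4; 5; 21; 6; 24; 7; 7; 24; 20; 20; 5; 7; 24; 8; 7; 20; 20; 6; 24; 8; 6;
  24; 20; 20; 6; 7; 6; 24; 20; 20; 7; 7; 20; 6; 24; 20; 20; 7; 20; 20; 20; 20; 4; 5;
  21; 6; 24; 7; 7; 24; 20; 20; 5; 7; 24; 8; 7; 24; 20; 20; 21; 6; 24; 24; 8; 23; 20;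
  7; 8; 23; 20; 6; 7; 24; 20; 23; 22; 20; 20; 4; 5; 7; 24; 8; 7; 20; 20; 6; 24; 8; 6;
  24; 20; 20; 6; 7; 6; 24; 20; 20; 7; 7; 20; 6; 24; 20; 20; 7; 20; 20; 20; 20; 5; 7;
  24; 8; 7; 24; 20; 20; 21; 6; 24; 24; 8; 23; 20; 7; 8; 23; 20; 6; 7; 24; 20; 23; 22;
  20; 20; 6; 7; 8; 23; 20; 6; 7; 24; 20; 23; 23; 20; 8; 20; 20; 20; 9; 20; 20; 20; 20;
  8; 6; 7; 23; 20; 22; 20; 5; 7; 24; 20; 22; 22; 20; 5; 6; 24; 20; 23; 23; 20; 20; 7;
  6; 7; 24; 23; 20; 22; 20; 5; 7; 24; 20; 22; 22; 20; 5; 6; 24; 20; 23; 23; 20; 20; 9;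
  20; 8; 20; 20; 20; 20; 20; 7; 20; 20; 20; 20; 20; 20; 3; 4; 5; 7; 24; 8; 7; 20; 20;
  6; 24; 24; 7; 5; 24; 20; 20; 7; 7; 8; 20; 20; 8; 5; 24; 20; 20; 7; 5; 24; 20; 20;
  20; 5; 7; 24; 24; 5; 6; 24; 20; 6; 24; 20; 20; 6; 24; 8; 6; 24; 20; 20; 8; 5; 7; 24;
  24; 20; 6; 24; 20; 7; 20; 20; 20; 20; 6; 6; 24; 20; 5; 24; 20; 20; 6; 7; 20; 20; 20;
  20; 20; 7; 20; 20; 20; 20; 7; 20; 20; 20; 20; 20; 20; 5; 5; 6; 8; 24; 20; 7; 24; 8;
  20; 20; 20; 7; 20; 20; 8; 20; 20; 20; 20; 6; 7; 24; 8; 20; 20; 7; 22; 20; 20; 7; 7;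
  23; 20; 6; 24; 23; 20; 20; 8; 20; 20; 20; 7; 20; 20; 20; 20; 20; 6; 6; 7; 24; 8; 20;
  20; 7; 22; 20; 20; 6; 8; 24; 20; 5; 24; 23; 20; 20; 7; 5; 24; 23; 20; 22; 20; 20; 5;
  6; 7; 24; 20; 7; 24; 20; 7; 20; 20; 20; 8; 20; 20; 20; 20; 20; 7; 7; 23; 20; 6; 24;
  23; 20; 20; 6; 6; 24; 23; 20; 6; 24; 23; 20; 20; 20; 8; 20; 20; 9; 20; 20; 20; 20;
  20; 9; 20; 20; 20; 20; 20; 4; 5; 7; 24; 8; 7; 24; 20; 20; 6; 24; 8; 6; 24; 20; 20;
  6; 6; 7; 24; 20; 7; 24; 20; 20; 7; 7; 24; 20; 6; 24; 20; 20; 7; 20; 20; 20; 8; 20;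
  20; 20; 20; 20; 5; 7; 24; 8; 7; 24; 20; 20; 21; 6; 24; 24; 8; 23; 20; 7; 8; 23; 20;
  6; 7; 24; 20; 23; 22; 20; 20; 5; 6; 24; 8; 6; 24; 20; 20; 6; 24; 24; 8; 23; 20; 21;
  6; 8; 23; 20; 6; 7; 24; 22; 20; 23; 20; 20; 6; 7; 8; 23; 20; 6; 7; 24; 20; 23; 22;
  20; 20; 6; 7; 8; 20; 5; 24; 23; 20; 20; 8; 23; 20; 5; 7; 24; 20; 23; 23; 20; 20; 7;
  6; 7; 24; 22; 20; 23; 20; 5; 7; 24; 20; 23; 23; 20; 5; 6; 24; 20; 22; 22; 20; 20; 7;
  20; 20; 20; 20; 9; 20; 20; 20; 20; 20; 4; 5; 5; 24; 7; 7; 24; 20; 20; 5; 24; 8; 7;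
  24; 20; 20; 8; 5; 7; 24; 20; 20; 5; 7; 24; 20; 20; 20; 5; 5; 24; 24; 8; 23; 20; 5;
  24; 24; 8; 23; 20; 8; 5; 7; 24; 22; 20; 23; 20; 5; 6; 24; 22; 20; 23; 20; 20; 5; 8;
  7; 23; 20; 5; 7; 24; 20; 22; 23; 20; 20; 8; 6; 7; 24; 20; 23; 23; 20; 5; 7; 22; 20;
  23; 20; 5; 6; 24; 22; 20; 22; 20; 20; 5; 7; 7; 24; 23; 20; 6; 24; 23; 20; 20; 7; 23;
  20; 6; 7; 24; 20; 23; 23; 20; 20; 8; 20; 20; 20; 20; 9; 20; 20; 20; 20; 20; 4; 5; 5;
  6; 8; 24; 20; 7; 24; 23; 20; 20; 6; 7; 24; 20; 7; 24; 23; 20; 20; 7; 8; 20; 20; 20;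
  20; 8; 20; 20; 20; 20; 20; 5; 6; 8; 24; 20; 7; 24; 23; 20; 20; 6; 6; 24; 22; 20; 22;
  20; 6; 8; 20; 20; 20; 20; 20; 20; 5; 6; 7; 24; 20; 7; 24; 23; 20; 20; 6; 6; 24; 22;
  20; 22; 20; 9; 20; 20; 20; 9; 20; 8; 20; 20; 20; 20; 20; 9; 6; 7; 20; 20; 20; 20; 7;
  20; 20; 20; 20; 20; 20; 20; 20; 5; 7; 8; 23; 20; 5; 7; 24; 20; 23; 23; 20; 8; 20;
  20; 20; 9; 20; 20; 20; 20; 8; 6; 7; 24; 20; 22; 22; 20; 5; 7; 23; 20; 22; 20; 5; 6;
  24; 23; 20; 23; 20; 20; 7; 6; 7; 24; 20; 22; 22; 20; 5; 7; 24; 23; 20; 22; 20; 5; 6;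
  24; 23; 20; 23; 20; 20; 9; 20; 8; 20; 20; 20; 20; 20; 7; 20; 20; 20; 20; 20; 20; 5;
  5; 6; 8; 20; 7; 24; 23; 20; 20; 8; 23; 20; 6; 7; 24; 23; 20; 23; 20; 20; 6; 8; 23;
  20; 5; 6; 24; 20; 23; 22; 20; 20; 6; 6; 7; 24; 23; 20; 23; 20; 5; 6; 24; 22; 20; 23;
  20; 5; 6; 22; 20; 22; 20; 20; 6; 20; 20; 20; 20; 9; 20; 20; 20; 20; 20; 5; 5; 6; 8;
  9; 20; 20; 20; 20; 7; 20; 20; 20; 20; 20; 20; 9; 20; 20; 20; 20; 7; 8; 20; 20; 20;
  20; 8; 20; 20; 20; 20; 20; 6; 20; 20; 20; 20; 20; 9; 20; 20; 20; 20; 20; 5; 9; 20;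
  8; 20; 20; 20; 6; 20; 7; 20; 20; 20; 20; 7; 8; 20; 20; 20; 20; 8; 20; 20; 20; 20; 6;
  20; 20; 20; 20; 20; 20; 10; 20; 6; 20; 20; 20; 20; 20; 20; 6; 20; 20; 20; 20; 20;
  20; 20; 20].

(** The other four patterns clash at once: the ends of a critical stretch of one or two edges have
    degree 2 in the critical part and are too close to each other. *)
Definition cycle_script (p : bitseq) : seq nat :=
  if p == nseq 5 true then script_five
  else if p == rcons (nseq 4 true) false then script_four
  else if p == nseq 3 true ++ nseq 2 false then script_three
  else [::].

(* One pattern in each nonzero class under rotation. *)
Definition patterns : seq bitseq :=
  [:: [:: true; false; false; false; false];
      [:: true; true; false; false; false];
      [:: true; false; true; false; false];
      [:: true; true; true; false; false];
      [:: true; true; false; true; false];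
      [:: true; true; true; true; false];
      [:: true; true; true; true; true]].

Lemma patterns_rot p : size p = 5 -> has id p ->
  exists2 r, r < 5 & rot r p \in patterns.
Proof.
case: p => [|b0 [|b1 [|b2 [|b3 [|b4 [|]]]]]] //= _.
suff: forall c0 c1 c2 c3 c4, [|| c0, c1, c2, c3, c4 | false] ==>
    has (fun r => rot r [:: c0; c1; c2; c3; c4] \in patterns) (iota 0 5).
  move=> H /(implyP (H _ _ _ _ _))/hasP[r]; rewrite mem_iota => lt_r rP.
  by exists r.
by do 5!case.
Qed.

Lemma patterns_refuted : all (fun p => refute 20 (cycle_state p) (cycle_script p)) patterns.
Proof. by lazy. Qed.

(** * Induced subgraphs *)

Lemma adj_neq (G : sgraph) (x y : G) : x -- y -> x != y.
Proof. by apply: contraTneq => ->; rewrite adj_irr. Qed.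

Lemma induced_adj (G : sgraph) (S : {set G}) (u v : induced S) :
  (u -- v) = (val u -- val v).
Proof.
rewrite /= /sym_rel (adj_sym (val v)) orbb andb_idl // => /adj_neq.
by apply: contraNneq => ->.
Qed.

Lemma contains_embed (G F : sgraph) (g : F -> G) : injective g ->
  (forall x y, (g x -- g y) = (x -- y)) -> contains G F.
Proof.
move=> g_inj g_adj; pose S := [set g x | x in F].
have gS x : g x \in S by apply: imset_f.
pose j x : induced S := exist (fun y => y \in S) (g x) (gS x).
have j_inj : injective j by move=> x y [/g_inj].
have [|f jK fK] := inj_card_bij j_inj.
  by rewrite card_sig (eq_card (B := S)) // card_imset.
exists S, f; split; first by exists j.
by move=> x y; rewrite -{2}(fK x) -{2}(fK y) induced_adj /= g_adj.
Qed.

Lemma contains_inv (G F : sgraph) : contains G F ->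
  exists2 g : F -> G, injective g & forall x y, (g x -- g y) = (x -- y).
Proof.
case=> S [f [[j jK fK] f_adj]]; exists (fun x => val (j x)).
  by move=> x y /val_inj/(can_inj fK).
by move=> x y; rewrite -induced_adj -f_adj !fK.
Qed.

Section Free.

Variable G : sgraph.

Lemma claw_free (x a b c : G) : ~ contains G claw ->
  x -- a -> x -- b -> x -- c -> a != b -> a != c -> b != c ->
  [|| a -- b, a -- c | b -- c].
Proof.
move=> noF xa xb xc nab nac nbc; apply: contraT; rewrite !negb_or.
case/and3P=> ab ac bc; case: noF.
have xNa := adj_neq xa; have xNb := adj_neq xb; have xNc := adj_neq xc.
pose g (u : claw) := match u with inl _ => x | inr i => nth x [:: a; b; c] i end.
apply: (@contains_embed _ _ g).
  move=> [[[|//] ?]|[[|[|[|//]]] ?]] [[[|//] ?]|[[|[|[|//]]] ?]] /= /eqP;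
  rewrite ?(negPf nab) ?(negPf nac) ?(negPf nbc) ?(negPf xNa) ?(negPf xNb) ?(negPf xNc) //;
  rewrite 1?eq_sym ?(negPf nab) ?(negPf nac) ?(negPf nbc) ?(negPf xNa) ?(negPf xNb) ?(negPf xNc) //;
  by move=> _; congr (_ _); apply: val_inj.
move=> [[[|//] ?]|[[|[|[|//]]] ?]] [[[|//] ?]|[[|[|[|//]]] ?]] /=;
  rewrite /sym_rel /= ?adj_irr ?andbF //;
  by rewrite ?(adj_sym b a) ?(adj_sym c a) ?(adj_sym c b) ?(adj_sym _ x)
    ?(negPf ab) ?(negPf ac) ?(negPf bc) ?xa ?xb ?xc ?andbF ?andbT.
Qed.

Lemma diamond_free (a b c d : G) : ~ contains G diamond ->
  a -- c -> a -- d -> b -- c -> b -- d -> c -- d -> a != b -> a -- b.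
Proof.
move=> noF ac ad bc bd cd nab; apply: contraT => ab; case: noF.
pose g (u : diamond) := nth a [:: a; b; c; d] (u : 'I_4).
have uN : uniq [:: a; b; c; d].
  rewrite /= !inE !negb_or nab (adj_neq ac) (adj_neq ad) (adj_neq bc).
  by rewrite (adj_neq bd) (adj_neq cd).
apply: (@contains_embed _ _ g).
  by move=> i j /eqP; rewrite nth_uniq ?ltn_ord // => /eqP/val_inj.
move=> [i lt_i] [j lt_j]; rewrite /= /sym_rel /= /sym_rel /=.
rewrite !eqEsubset !subUset !sub1set !inE -!val_eqE /= !inordK //.
case: i lt_i => [|[|[|[|//]]]] lt_i; case: j lt_j => [|[|[|[|//]]]] lt_j;
  rewrite /g /= ?adj_irr //;
  by rewrite ?(adj_sym b a) ?(adj_sym c a) ?(adj_sym d a) ?(adj_sym c b) ?(adj_sym d b)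
    ?(adj_sym d c) ?(negPf ab) ?ac ?ad ?bc ?bd ?cd.
Qed.

Lemma K4_free (a b c d : G) : ~ contains G (complete_graph 4) ->
  a -- b -> a -- c -> a -- d -> b -- c -> b -- d -> c -- d -> False.
Proof.
move=> noF ab ac ad bc bd cd; apply: noF.
pose g (u : complete_graph 4) := nth a [:: a; b; c; d] (u : 'I_4).
have uN : uniq [:: a; b; c; d].
  rewrite /= !inE !negb_or (adj_neq ab) (adj_neq ac) (adj_neq ad) (adj_neq bc).
  by rewrite (adj_neq bd) (adj_neq cd).
apply: (@contains_embed _ _ g).
  by move=> i j /eqP; rewrite nth_uniq ?ltn_ord // => /eqP/val_inj.
move=> [i lt_i] [j lt_j]; rewrite /= /sym_rel /= -val_eqE /=.
case: i lt_i => [|[|[|[|//]]]] lt_i; case: j lt_j => [|[|[|[|//]]]] lt_j;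
  rewrite /g /= ?adj_irr //;
  by rewrite ?(adj_sym b a) ?(adj_sym c a) ?(adj_sym d a) ?(adj_sym c b) ?(adj_sym d b)
    ?(adj_sym d c) ?ab ?ac ?ad ?bc ?bd ?cd.
Qed.

End Free.

(** * Paths in graphs of maximum degree 2, colour lists and edge counting *)

(** Components of a graph of maximum degree 2 are paths or cycles, so they have at most two ends.
    Duplicate-free paths from [a] to [b] and to [c] start with the same edge and then agree step by
    step, until one of them stops at an inner vertex of the other. *)
Lemma two_ended (T : finType) (e : rel T) (a b c : T) :
    symmetric e ->
    (forall x y1 y2 y3, e x y1 -> e x y2 -> e x y3 ->
      [|| y1 == y2, y1 == y3 | y2 == y3]) ->
    {in [:: a; b; c], forall x y1 y2, e x y1 -> e x y2 -> y1 = y2} ->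
  uniq [:: a; b; c] -> connect e a b -> connect e a c -> False.
Proof.
move=> e_sym e_two e_end; rewrite /= !inE negb_or andbT => /andP[/andP[nab nac] nbc].
(* Here [t] is the common predecessor of [x] on the two paths; it uses up one of the two neighbours
   of [x]. *)
have aux p q x t : e x t -> path e x p -> path e x q -> t \notin p -> t \notin q ->
    uniq (x :: p) -> uniq (x :: q) -> last x p = b -> last x q = c -> False.
  elim: p q x t => [|y p IHp] [|z q] x t xt /=.
  - by move=> _ _ _ _ _ _ -> E; rewrite E eqxx in nbc.
  - move=> _ /andP[xz _] _; rewrite inE negb_or => /andP[ntz _] _ _ xb _.
    by rewrite (e_end x _ t z) ?eqxx // xb !inE eqxx orbT in ntz.
  - move=> /andP[xy _] _; rewrite inE negb_or => /andP[nty _] _ _ _ _ xc.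
    by rewrite (e_end x _ t y) ?eqxx // xc !inE eqxx !orbT in nty.
  case/andP=> xy yp /andP[xz zq]; rewrite !inE !negb_or.
  case/andP=> nty tp /andP[ntz tq] /andP[/andP[nxy xp] /andP[nyp up]].
  case/andP=> /andP[nxz xq] /andP[nzq uq].
  have zy : y = z.
    have := e_two _ _ _ _ xt xy xz; rewrite (negPf nty) (negPf ntz) /=.
    by move/eqP.
  rewrite -{}zy in xz zq ntz nxz nzq *.
  apply: (IHp q y x) => //; first by rewrite e_sym.
  - by rewrite /= nyp.
  by rewrite /= nzq.
case/connectP=> p ap bE /connectP[q aq cE].
case/shortenP: ap bE => p' ap' up' _ bE; case/shortenP: aq cE => q' aq' uq' _ cE.
case: p' ap' up' bE => [|y p'] /=; first by move=> _ _ E; rewrite E eqxx in nab.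
case: q' aq' uq' cE => [|z q'] /=; first by move=> _ _ E; rewrite E eqxx in nac.
case/andP=> az zq; rewrite inE negb_or => /and3P[/andP[naz aq] nzq uq] cE.
case/andP=> ay yp; rewrite inE negb_or => /and3P[/andP[nay ap] nyp up] bE.
have zy : y = z by apply: (e_end a) => //; rewrite mem_head.
rewrite -{}zy in az zq naz nzq cE.
apply: (aux p' q' y a) => //=; first by rewrite e_sym.
- by rewrite nyp.
by rewrite nzq.
Qed.

Lemma cards_remove (T : finType) (A : {set T}) x n :
  x \in A -> #|A| = n.+1 -> #|A :\ x| = n.
Proof. by move=> xA; rewrite (cardsD1 x) xA add1n => -[]. Qed.

Lemma set2_eq (T : finType) (u v a b : T) : u != v -> [set u; v] = [set a; b] ->
  (a, b) = (u, v) \/ (a, b) = (v, u).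
Proof.
move=> nuv E; have /set2P ua : u \in [set a; b] by rewrite -E !inE eqxx.
have /set2P va : v \in [set a; b] by rewrite -E !inE eqxx orbT.
case: ua va nuv => -> [] -> //; rewrite ?eqxx //; first by left.
by right.
Qed.

Lemma proper_listP (T : eqType) (D : seq ((T * T) * nat)) d e : proper_list D ->
  d \in D -> e \in D -> d != e -> touch d.1 e.1 -> d.2 != e.2.
Proof.
have touchC (p q : T * T) : touch p q = touch q p.
  rewrite /touch ![q.1 == _]eq_sym ![q.2 == _]eq_sym.
  by do !case: (_ == _).
elim: D => [//|f D IHD] /= /andP[/allP fD prD].
rewrite !inE => /predU1P[->|dD] /predU1P[->|eD] nde.
- by rewrite eqxx in nde.
- by move=> t; have := fD _ eD; rewrite t.
- by rewrite touchC => t; have := fD _ dD; rewrite t eq_sym.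
exact: IHD.
Qed.

Section OrdGraph.

Variables (n : nat) (H : sgraph) (num : H -> nat).
Hypothesis num_inj : injective num.

(** Orienting each edge upwards along the numbering counts it exactly once. *)
Definition arcs : {set H * H} := [set p | (num p.1 < num p.2) && (p.1 -- p.2)].

Lemma edges_card : #|edges H| = #|arcs|.
Proof.
have -> : edges H = [set [set p.1; p.2] | p in arcs].
  apply/setP=> e; apply/imsetP/imsetP => -[[x y]]; rewrite inE /= => xy ->.
    have [lt|gt|/num_inj E] := ltngtP (num x) (num y).
    - by exists (x, y); rewrite // inE /= lt.
    - by exists (y, x); rewrite ?inE /= ?gt 1?adj_sym // setUC.
    by rewrite E adj_irr in xy.
  by exists (x, y); rewrite ?inE //; case/andP: xy.
rewrite card_in_imset // => -[x y] [z w]; rewrite !inE /= => /andP[xy _] /andP[zw _] E.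
have nxy : x != y by apply: contraTneq xy => ->; rewrite ltnn.
have [[-> ->]//|[zy wx]] := set2_eq nxy E.
by rewrite zy wx in zw; lia.
Qed.

Lemma degree_sum : \sum_(x : H) #|[set y | x -- y]| = 2 * #|arcs|.
Proof.
have -> : \sum_(x : H) #|[set y | x -- y]| = #|[set p : H * H | p.1 -- p.2]|.
  rewrite -sum1_card (eq_bigr (fun x : H => \sum_(y : H | x -- y) 1)) => [|x _].
    by rewrite pair_big_dep /=; apply: eq_bigl => p; rewrite inE.
  by rewrite -sum1_card; apply: eq_bigl => y; rewrite inE.
pose sw (p : H * H) := (p.2, p.1).
have sw_inj : injective sw by move=> [x y] [z w] [-> ->].
rewrite mul2n -addnn -{2}(card_imset arcs sw_inj) -cardsUI [X in _ + X]eq_card0 ?addn0.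
  apply: eq_card => -[x y]; rewrite !inE /=; apply/idP/idP => [xy|].
    have [lt|gt|/num_inj E] := ltngtP (num x) (num y); last by rewrite E adj_irr in xy.
      by rewrite xy.
    by apply/orP; right; apply/imsetP; exists (y, x); rewrite // inE /= gt adj_sym.
  case/orP=> [/andP[]//|/imsetP[[z w]]].
  by rewrite inE /= => /andP[_ zw] [-> ->]; rewrite adj_sym.
move=> [x y]; rewrite !inE /=; apply/negP=> /andP[/andP[lt _] /imsetP[[z w]]].
by rewrite inE /= => /andP[lt' _] [E1 E2]; rewrite E1 E2 in lt; lia.
Qed.

End OrdGraph.

(** * The root of a line graph *)

Section Lines.

Variable G : sgraph.
Hypothesis noclaw : ~ contains G claw.
Hypothesis nodiamond : ~ contains G diamond.
Hypothesis noK4 : ~ contains G (complete_graph 4).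
Hypothesis isolated_free : forall x : G, exists y, x -- y.

(** For adjacent [x] and [y] this is the unique maximal clique containing them. The lines become the
    vertices of the root, as in Krausz's clique partition of a line graph. *)
Definition line (x y : G) : {set G} :=
  [set z | [|| z == x, z == y | (x -- z) && (y -- z)]].

(* A vertex whose neighbourhood is a clique also gets the line [[set x]], so that
   every vertex of [G] has exactly two ends. *)
Definition root_ends (x : G) : {set {set G}} :=
  [set line x y | y in [set y | x -- y]] :|:
  [set L | (L == [set x]) &&
     [forall y : G, forall z : G, (x -- y) && (x -- z) ==> (y == z) || (y -- z)]].

Lemma lineC x y : line x y = line y x.
Proof. by apply/setP=> z; rewrite !inE orbCA [X in [|| _, _ | X]]andbC. Qed.

(** Two common neighbours of an edge span with it a diamond or, if adjacent, a [K4]. *)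
Lemma common_uniq (x y z w : G) : x -- y -> x -- z -> y -- z -> x -- w -> y -- w -> z = w.
Proof.
move=> xy xz yz xw yw; apply/eqP; apply: contraT => nzw; case: noK4.
have zw : z -- w.
  apply: (diamond_free (c := x) (d := y) nodiamond) => //;
  by rewrite // adj_sym.
by case: (K4_free noK4 xy xz xw yz yw zw).
Qed.

Lemma line_eq x y z : x -- y -> z \in line x y -> z != x -> line x z = line x y.
Proof.
move=> xy + nzx; rewrite !inE (negPf nzx) /= => /predU1P[->//|/andP[xz yz]].
apply/setP=> t; rewrite !inE; case: eqP => //= _.
apply/orP/orP=> [[/eqP->|/andP[xt zt]]|[/eqP->|/andP[xt yt]]].
- by right; rewrite xz yz.
- left; apply/eqP/esym; apply: (common_uniq xz xy) => //; by rewrite // adj_sym.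
- by right; rewrite xy adj_sym yz.
by left; apply/eqP/esym; apply: (common_uniq xy).
Qed.

Lemma line_card x y : x -- y -> #|line x y| <= 3.
Proof.
move=> xy; have [z /andP[xz yz]|no_z] := pickP (fun z => (x -- z) && (y -- z)).
  apply: leq_trans (subset_leq_card _ : _ <= #|[set x; y; z]|) _.
    apply/subsetP=> w; rewrite !inE => /or3P[->|->|/andP[xw yw]]; rewrite ?orbT //.
    by rewrite (common_uniq xy xz yz xw yw) eqxx orbT.
  by rewrite setUC cardsU1 cards2; case: (_ \notin _); case: (_ != _).
apply: leq_trans (subset_leq_card _ : _ <= #|[set x; y]|) _.
  by apply/subsetP=> w; rewrite !inE no_z orbF.
by rewrite cards2; case: (_ != _).
Qed.

Lemma line_ends x y : x -- y -> line x y \in root_ends x.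
Proof. by move=> xy; rewrite inE imset_f ?inE. Qed.

Lemma root_endsP x L : L \in root_ends x ->
  (exists2 y, x -- y & L = line x y) \/
  (L = [set x] /\ forall y z, x -- y -> x -- z -> y != z -> y -- z).
Proof.
rewrite !inE => /orP[/imsetP[y]|/andP[/eqP-> /forallP clq]].
  by rewrite inE => xy ->; left; exists y.
right; split=> // y z xy xz; have /forallP/(_ z) := clq y.
by rewrite xy xz /=; case: eqP.
Qed.

Lemma root_ends_mem x L : L \in root_ends x -> x \in L.
Proof. by case/root_endsP=> [[y _ ->]|[-> _]]; rewrite !inE eqxx. Qed.

Lemma root_ends_line x y L : L \in root_ends x -> y \in L -> y != x -> x -- y /\ L = line x y.
Proof.
case/root_endsP=> [[z xz ->] yL nyx|[-> _]]; last by rewrite inE => ->.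
rewrite (line_eq xz yL nyx); split=> //.
by move: yL; rewrite !inE (negPf nyx) => /predU1P[->//|/andP[]].
Qed.

Lemma root_ends_trans x y L : L \in root_ends x -> y \in L -> L \in root_ends y.
Proof.
move=> Lx yL; have [->//|nyx] := eqVneq y x.
by have [xy ->] := root_ends_line Lx yL nyx; rewrite lineC line_ends // adj_sym.
Qed.

(** If the neighbours of [x] form a clique, they lie on one line and [[set x]] is the second end.
    Otherwise take non-adjacent neighbours [a] and [b]: since there is no claw, every other
    neighbour is adjacent to one of them and lies on its line. *)
Lemma root_ends_card x : #|root_ends x| = 2.
Proof.
have [y xy] := isolated_free x.
have line1 : line x y != [set x].
  by apply/eqP=> /setP/(_ y); rewrite !inE eqxx orbT eq_sym (negPf (adj_neq xy)).
have [clq|] := boolP [forall y : G, forall z : G, (x -- y) && (x -- z) ==> (y == z) || (y -- z)].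
  suff -> : root_ends x = [set line x y; [set x]] by rewrite cards2 line1.
  have {}clq z : x -- z -> (y == z) || (y -- z).
    by move=> xz; have /forallP/(_ z) := forallP clq y; rewrite xy xz.
  apply/setP=> L; apply/idP/set2P => [/root_endsP[[z xz ->]|[-> _]]|[]->]; first 1 last.
  - by right.
  - exact: line_ends.
  - rewrite !inE eqxx /=; apply/orP; right; apply/forallP=> a; apply/forallP=> b.
    apply/implyP=> /andP[xa xb].
    have [->|nab] := eqVneq a b; first by [].
    have [yEa|nya] := eqVneq y a; first by have := clq b xb; rewrite yEa (negPf nab).
    have [yEb|nyb] := eqVneq y b.
      by have := clq a xa; rewrite yEb eq_sym (negPf nab) adj_sym.
    have ya := clq a xa; have yb := clq b xb; rewrite (negPf nya) (negPf nyb) /= in ya yb.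
    by case/eqP: nab; apply: (common_uniq xy).
  left; apply: line_eq => //; last by rewrite eq_sym adj_neq.
  by rewrite !inE xz /= [z == y]eq_sym clq ?orbT.
case/forallPn=> a /forallPn[b]; rewrite negb_imply negb_or => /andP[/andP[xa xb] /andP[nab ab]].
have nlab : line x a != line x b.
  apply/eqP=> /setP/(_ b); rewrite !inE eqxx orbT.
  by rewrite ![b == _]eq_sym (negPf (adj_neq xb)) (negPf nab) (negPf ab) andbF.
suff -> : root_ends x = [set line x a; line x b] by rewrite cards2 nlab.
apply/setP=> L; apply/idP/set2P => [/root_endsP[[z xz ->]|[_ clq]]|[]->]; try exact: line_ends.
  have [->|nza] := eqVneq z a; first by left.
  have [->|nzb] := eqVneq z b; first by right.
  have := claw_free noclaw xa xb xz nab; rewrite (negPf ab) ![_ == z]eq_sym nza nzb.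
  have nzx : z != x by rewrite eq_sym adj_neq.
  move=> /(_ isT isT)/= /orP[az|bz]; [left|right].
    by apply: (line_eq xa) nzx; rewrite !inE xz az !orbT.
  by apply: (line_eq xb) nzx; rewrite !inE xz bz !orbT.
by rewrite clq in ab.
Qed.

(** The root has no parallel edges, because two distinct lines share at most one vertex. *)
Lemma root_ends_inj x y L M : L != M ->
  L \in root_ends x -> M \in root_ends x -> L \in root_ends y -> M \in root_ends y -> x = y.
Proof.
move=> nLM Lx Mx Ly My; apply/eqP; apply: contraNT nLM; rewrite eq_sym => nyx.
have [_ ->] := root_ends_line Lx (root_ends_mem Ly) nyx.
by have [_ ->] := root_ends_line Mx (root_ends_mem My) nyx.
Qed.

Lemma root_ends_adj x y : x != y ->
  reflect (exists2 L, L \in root_ends x & L \in root_ends y) (x -- y).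
Proof.
move=> nxy; apply: (iffP idP) => [xy|[L Lx Ly]].
  by exists (line x y); [apply: line_ends|rewrite lineC line_ends // adj_sym].
by have [] := root_ends_line Lx (root_ends_mem Ly); rewrite 1?eq_sym.
Qed.

Lemma root_ends_degree L : #|[set x | L \in root_ends x]| <= 3.
Proof.
have [->|[x]] := set_0Vmem [set x | L \in root_ends x]; first by rewrite cards0.
rewrite inE => Lx.
apply: leq_trans (subset_leq_card _ : _ <= #|L|) _.
  by apply/subsetP=> y; rewrite inE => /root_ends_mem.
by case/root_endsP: Lx => [[y xy ->]|[-> _]]; rewrite ?line_card ?cards1.
Qed.

Lemma root_ends_lt3 x L M N : L != M -> M != N -> L != N ->
  L \in root_ends x -> M \in root_ends x -> N \in root_ends x -> False.
Proof.
move=> nLM nMN nLN Lx Mx Nx; have := root_ends_card x.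
by apply/eqP; rewrite gtn_eqF //; apply/card_gt2P; exists L, M, N; do 2!split; rewrite // eq_sym.
Qed.

(** A triangle in the root makes [x], [y], [z] a triangle of [G], which lies on a single line. So
    [M], the line of [x] and [y], also contains [z] and would be a third end of it. *)
Lemma root_ends_triangle x y z L M N : L != M -> M != N -> L != N ->
  L \in root_ends x -> M \in root_ends x -> M \in root_ends y -> N \in root_ends y ->
  N \in root_ends z -> L \in root_ends z -> False.
Proof.
move=> nLM nMN nLN Lx Mx My Ny Nz Lz.
have nyx : y != x.
  by apply/eqP=> E; rewrite E in Ny; apply: (root_ends_lt3 nLM nMN nLN Lx Mx Ny).
have nzx : z != x.
  by apply/eqP=> E; rewrite E in Nz; apply: (root_ends_lt3 nLM nMN nLN Lx Mx Nz).
have nzy : z != y.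
  by apply/eqP=> E; rewrite E in Lz; apply: (root_ends_lt3 nLM nMN nLN Lz My Ny).
have [xy ME] := root_ends_line Mx (root_ends_mem My) nyx.
have [xz _] := root_ends_line Lx (root_ends_mem Lz) nzx.
have [yz _] := root_ends_line Ny (root_ends_mem Nz) nzy.
have zM : z \in M by rewrite ME !inE xz yz !orbT.
exact: (root_ends_lt3 nLM nMN nLN Lz (root_ends_trans Mx zM) Nz).
Qed.

End Lines.

(** * The root graph, given by the ends of its edges *)

Section Root.

Variables (G : sgraph) (V : finType) (ends : G -> {set V}).
Hypothesis ends_card : forall x, #|ends x| = 2.
Hypothesis ends_inj : forall x y u v, u != v ->
  u \in ends x -> v \in ends x -> u \in ends y -> v \in ends y -> x = y.
Hypothesis ends_adj : forall x y, x != y ->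
  reflect (exists2 u, u \in ends x & u \in ends y) (x -- y).
Hypothesis ends_degree : forall u, #|[set x | u \in ends x]| <= 3.
Hypothesis ends_triangle : forall x y z u v w, u != v -> v != w -> u != w ->
  u \in ends x -> v \in ends x -> v \in ends y -> w \in ends y ->
  w \in ends z -> u \in ends z -> False.

Implicit Types (x y z : G) (u v w : V) (A B Y : {set G}).

(** The vertices of [G] are the edges of the root; [link A] is adjacency along those in [A], and
    [inc A u] is the set of those at [u]. *)
Definition link (A : {set G}) (u v : V) : bool := [exists x in A, ends x == [set u; v]].

Definition inc (A : {set G}) (u : V) : {set G} := [set x in A | u \in ends x].

Lemma linkP A u v :
  reflect (exists2 x, x \in A & ends x = [set u; v]) (link A u v).
Proof. by apply: (iffP exists_inP) => -[x xA /eqP]; exists x. Qed.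

Lemma link_sym A : symmetric (link A).
Proof. by move=> u v; apply/linkP/linkP => -[x xA E]; exists x; rewrite // E setUC. Qed.

Lemma ends_neq x u v : ends x = [set u; v] -> u != v.
Proof. by move=> E; have := ends_card x; rewrite E cards2; case: (u != v). Qed.

Lemma link_irr A : irreflexive (link A).
Proof. by move=> u; apply/negbTE/negP=> /linkP[x _ /ends_neq]; rewrite eqxx. Qed.

Lemma link_sub A B : A \subset B -> subrel (link A) (link B).
Proof. by move=> /subsetP sAB u v /linkP[x /sAB xB E]; apply/linkP; exists x. Qed.

Lemma ends_other x u : u \in ends x -> exists2 v, v != u & ends x = [set u; v].
Proof.
move=> ux; have /cards2P[a [b [nab E]]] : #|ends x| == 2 by rewrite ends_card.
move: ux; rewrite E !inE => /orP[]/eqP->.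
  by exists b; rewrite // eq_sym.
by exists a; rewrite // setUC.
Qed.

Lemma ends_eq x y u v : ends x = [set u; v] -> u \in ends y -> v \in ends y -> x = y.
Proof.
move=> E uy vy; apply: (ends_inj (ends_neq E)) => //; by rewrite E !inE eqxx ?orbT.
Qed.

Lemma link_card A u : #|[set w | link A u w]| = #|inc A u|.
Proof.
pose oth x := odflt u [pick v | (v != u) && (ends x == [set u; v])].
have othP x : u \in ends x -> ends x = [set u; oth x].
  move=> /ends_other[v nvu E]; rewrite /oth; case: pickP => [w /andP[_ /eqP] //|/(_ v)].
  by rewrite nvu E eqxx.
have -> : [set w | link A u w] = oth @: inc A u.
  apply/setP=> w; rewrite inE; apply/linkP/imsetP => [[x xA E]|[x]].
    have ux : u \in ends x by rewrite E !inE eqxx.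
    exists x; first by rewrite inE xA.
    have := othP x ux; rewrite {1}E => /setP/(_ w).
    by rewrite !inE eqxx orbT eq_sym (negPf (ends_neq E)) => /esym/eqP.
  by rewrite inE => /andP[xA /othP xE] ->; exists x.
rewrite card_in_imset // => x y; rewrite !inE => /andP[_ ux] /andP[_ uy] oE.
by apply: (ends_eq (othP x ux)) => //; rewrite oE othP // !inE eqxx orbT.
Qed.

Lemma inc_card A u : #|inc A u| <= 3.
Proof.
apply: leq_trans (ends_degree u); apply: subset_leq_card.
by apply/subsetP=> x; rewrite !inE => /andP[].
Qed.

Lemma link_triangle A a b c : link A a b -> link A b c -> link A c a -> False.
Proof.
move=> /linkP[x _ xE] /linkP[y _ yE] /linkP[z _ zE].
apply: (@ends_triangle x y z a b c); rewrite ?xE ?yE ?zE ?inE ?eqxx ?orbT //.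
- exact: ends_neq xE.
- exact: ends_neq yE.
by rewrite eq_sym (ends_neq zE).
Qed.

Definition coloring (A : {set G}) (c : G -> 'I_3) : Prop :=
  {in A &, forall x y, x -- y -> c x != c y}.

Notation h := (link [set: G]).

(** * From subgraphs of the root to induced subgraphs *)

(** The map [f] need not reflect adjacency: whether two edges meet depends only on their ends, and
    [f] is injective on these. *)
Lemma contains_line_graph (F : sgraph) (f : F -> V) : injective f ->
  (forall x y : F, x -- y -> h (f x) (f y)) -> contains G (line_graph F).
Proof.
move=> f_inj f_link.
have ex (e : line_graph F) : exists x, ends x == f @: val e.
  case: e => e /= /imsetP[[x y]]; rewrite inE /= => /f_link/linkP[z _ zE] ->.
  by exists z; rewrite zE imsetU1 imset_set1.
pose g e := xchoose (ex e); have gE e : ends (g e) = f @: val e := eqP (xchooseP (ex e)).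
have g_inj : injective g.
  by move=> e e' E; apply/val_inj/(imset_inj f_inj); rewrite -!gE E.
apply: (contains_embed g_inj) => e e' /=; rewrite /sym_rel /=.
have [->|nee'] := eqVneq e e'; first by rewrite adj_irr.
have ngg : g e != g e' by rewrite (inj_eq g_inj).
rewrite [val e' :&: _]setIC orbb; apply/(ends_adj ngg)/set0Pn => [[u]|[x /setIP[xe xe']]].
  rewrite !gE => /imsetP[x xe ->] fx; exists x.
  by rewrite inE xe; move: fx; rewrite mem_imset.
by exists (f x); rewrite gE imset_f.
Qed.

Lemma occurs_link P f i j : occurs h P f -> i < size P -> j < size P ->
  all (fun k => all (gtn k) (nth [::] P k)) (iota 0 (size P)) ->
  (j \in nth [::] P i) || (i \in nth [::] P j) -> h (f i) (f j).
Proof.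
move=> [_ fP] lt_i lt_j /allP P_lt /orP[ji|ij].
  by apply: fP => //; apply: (allP (P_lt i _)) ji; rewrite mem_iota.
by rewrite link_sym; apply: fP => //; apply: (allP (P_lt j _)) ij; rewrite mem_iota.
Qed.

Lemma spider_N222 f : occurs h spider f -> contains G N222.
Proof.
(* [N222] is the line graph of the spider: [(i, j)] is the edge number [j] of leg [i], counted from
   the centre, with inner end [a] and outer end [b]. *)
move=> fP; pose a (p : N222) := if p.2 == 0 :> nat then 0 else 3 * p.1 + p.2.
pose b (p : N222) := 3 * p.1 + p.2.+1.
have lt_a p : a p < 10 by case: p => [[[|[|[|//]]] ?] [[|[|[|//]]] ?]].
have lt_b p : b p < 10 by case: p => [[[|[|[|//]]] ?] [[|[|[|//]]] ?]].
have ex p : exists x, ends x == [set f (a p); f (b p)].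
  suff /linkP[x _ xE] : h (f (a p)) (f (b p)) by exists x; rewrite xE.
  apply: (occurs_link fP) => //.
  by case: p => [[[|[|[|//]]] ?] [[|[|[|//]]] ?]].
pose g p := xchoose (ex p).
have gE p : ends (g p) = [set f (a p); f (b p)] := eqP (xchooseP (ex p)).
have fE i j : i < 10 -> j < 10 -> (f i == f j) = (i == j).
  by move=> lt_i lt_j; apply: (inj_in_eq fP.1).
have meetE p q : (exists2 u, u \in ends (g p) & u \in ends (g q)) <->
    [|| a p == a q, a p == b q, b p == a q | b p == b q].
  rewrite !gE; split=> [[u /set2P[]->]|].
  - by rewrite !inE !fE // => /orP[]->; rewrite ?orbT.
  - by rewrite !inE !fE // => /orP[]->; rewrite ?orbT.
  by case/or4P=> /eqP E; [exists (f (a p))|exists (f (a p))|exists (f (b p))|exists (f (b p))];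
    rewrite !inE ?E eqxx ?orbT.
have g_inj : injective g.
  move=> p q E; have : ends (g p) = ends (g q) by rewrite E.
  rewrite !gE => /setP S.
  have := S (f (a p)); have := S (f (b p)); have := S (f (b q)).
  rewrite !inE !fE // !eqxx ?orbT => + + +; rewrite /a /b.
  move=> S1 S2 S3; suff /andP[/eqP E1 /eqP E2] : (p.1 == q.1 :> nat) && (p.2 == q.2 :> nat).
    by rewrite [p]surjective_pairing [q]surjective_pairing (val_inj E1) (val_inj E2).
  move: S1 S2 S3.
  by case: p q {S E} => [[[|[|[|//]]] ?] [[|[|[|//]]] ?]] [[[|[|[|//]]] ?] [[|[|[|//]]] ?]].
apply: (contains_embed g_inj) => p q.
have [->|npq] := eqVneq p q; first by rewrite !adj_irr.
have ngg : g p != g q by rewrite (inj_eq g_inj).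
transitivity [|| a p == a q, a p == b q, b p == a q | b p == b q].
  by apply/(ends_adj ngg)/idP => /meetE.
have {}npq : (p.1 != q.1 :> nat) || (p.2 != q.2 :> nat).
  apply: contraNT npq; rewrite negb_or !negbK => /andP[/eqP E1 /eqP E2].
  by apply/eqP; rewrite [p]surjective_pairing [q]surjective_pairing (val_inj E1) (val_inj E2).
rewrite /= /sym_rel -[p == q]/((p.1 == q.1) && (p.2 == q.2)) -!val_eqE.
move: npq; rewrite /a /b.
by case: p q {ngg} => [[[|[|[|//]]] ?] [[|[|[|//]]] ?]] [[[|[|[|//]]] ?] [[|[|[|//]]] ?]].
Qed.

Lemma K33_B10 f : occurs h K33_subdivided f -> contains G B10.
Proof.
(* The subdivided edge of [D7] joins [inl 0] and [inr 0], that of the pattern joins 0 and 5; hence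
   the order 5, 1, 3. *)
move=> fP; pose a (x : D7) := match x with
  | None => 6
  | Some (inl i) => 2 * i
  | Some (inr j) => nth 0 [:: 5; 1; 3] j
  end.
have lt_a (x : D7) : a x < 7 by case: x => [[[[|[|[|//]]] ?]|[[|[|[|//]]] ?]]|].
apply: (@contains_line_graph D7 (f \o a)) => [x y /(fP.1)|x y].
  move=> /(_ (lt_a x) (lt_a y)).
  case: x y => [[[[|[|[|//]]] i]|[[|[|[|//]]] i]]|] [[[[|[|[|//]]] j]|[[|[|[|//]]] j]]|] //= _;
    by rewrite (bool_irrelevance i j).
move=> xy; apply: (occurs_link fP) => //; move: xy.
case: x y {lt_a} => [[[[|[|[|//]]] ?]|[[|[|[|//]]] ?]]|] [[[[|[|[|//]]] ?]|[[|[|[|//]]] ?]]|] //=.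
all: by rewrite /sym_rel /= /sym_rel /= ?eqEsubset ?subUset ?sub1set ?inE -?val_eqE /= ?andbF.
Qed.

Lemma petersen_minus_vertex_line f : occurs h petersen_minus f ->
  contains G (line_graph petersen_minus_vertex).
Proof.
(* At the deleted vertex [(false, 0)] the value is a meaningless 0, which collides with that of
   [(false, 1)]; injectivity is needed only off this vertex. *)
move=> fP; pose a (x : petersen) := if x.1 then nth 0 [:: 8; 4; 7; 5; 6] x.2 else x.2.-1.
have lt_a (x : petersen) : a x < 9 by case: x => [[] [[|[|[|[|[|//]]]]] ?]].
apply: (@contains_line_graph petersen_minus_vertex (f \o a \o val)) => [x y /(fP.1)|x y].
  move=> /(_ (lt_a _) (lt_a _)); case: x y => [x xP] [y yP] /= E; apply: val_inj => /=.
  move: xP yP E; rewrite !inE.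
  move=> x0 y0 E; suff /andP[/eqP E1 /eqP E2] : (x.1 == y.1) && (x.2 == y.2 :> nat).
    by rewrite [x]surjective_pairing [y]surjective_pairing E1 (val_inj E2).
  move: x0 y0 E.
  by case: x y => [[] [[|[|[|[|[|//]]]]] ?]] [[] [[|[|[|[|[|//]]]]] ?]].
rewrite induced_adj => xy; apply: (occurs_link fP) => //=; move: xy.
case: x y => [x xP] [y yP] /=; move: xP yP; rewrite !inE.
case: x y => [[] [[|[|[|[|[|//]]]]] ?]] [[] [[|[|[|[|[|//]]]]] ?]] //=.
Qed.

Lemma cycle9_overfull f : occurs h cycle9 f ->
    12 < count (fun p => h (f p.1) (f p.2)) pairs9 ->
  exists H : sgraph,
    [/\ overfull H, cycle_with_chords 9 4 H & contains G (line_graph H)].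
Proof.
move=> fP chords.
(* [H] keeps all edges of the root among the nine vertices, so that the number of chords is
   determined exactly. *)
pose hf (i j : 'I_9) := h (f i) (f j).
have hf_sym : symmetric hf by move=> i j; apply: link_sym.
have hf_irr : irreflexive hf by move=> i; apply: link_irr.
pose H := SGraph hf_sym hf_irr; exists H.
pose num (i : H) : nat := (i : 'I_9).
have num_inj : injective num by apply: val_inj.
have f_inj : injective (fun i : H => f (num i)).
  by move=> i j /(fP.1 _ _ (ltn_ord i) (ltn_ord j))/num_inj.
have deg (x : H) : #|[set y | x -- y]| <= 3.
  rewrite -(card_imset _ f_inj); apply: leq_trans (inc_card [set: G] (f (num x))).
  rewrite -link_card; apply: subset_leq_card.
  by apply/subsetP=> _ /imsetP[y + ->]; rewrite !inE.
(* The degree sum is even and at most 27, so there are at most 13 edges: the cycle and four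
   chords. *)
have arcs_le : 2 * #|arcs num| <= 27.
  rewrite -(degree_sum num_inj); apply: (@leq_trans (\sum_(x : H) 3)).
    by apply: leq_sum => x _; apply: deg.
  by rewrite sum_nat_const card_ord.
have arcs_ge : 12 < #|arcs num|.
  apply: leq_trans chords _; rewrite -size_filter.
  pose s := [seq p <- pairs9 | h (f p.1) (f p.2)].
  have lt_s p : p \in s -> [&& p.2 < p.1, p.1 < 9 & h (f p.1) (f p.2)].
    rewrite mem_filter => /andP[-> /allpairsPdep[i [j [+ + ->]]]] /=.
    by rewrite !mem_iota !add0n /= => -> ->.
  pose j (p : nat * nat) : H * H := (inord p.2, inord p.1).
  have j_inj : {in s &, injective j}.
    move=> p q /lt_s/and3P[p21 p1 _] /lt_s/and3P[q21 q1 _].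
    move=> [/(congr1 val) E2 /(congr1 val) E1]; move: E1 E2.
    rewrite /= !inordK // ?(ltn_trans p21) ?(ltn_trans q21) //.
    by case: p q {p21 p1 q21 q1} => [p1 p2] [q1 q2] /= -> ->.
  have s_uniq : uniq (map j s) by rewrite (map_inj_in_uniq j_inj) filter_uniq.
  rewrite -(size_map j) -(card_uniqP s_uniq); apply: subset_leq_card.
  apply/subsetP=> _ /mapP[p /lt_s/and3P[p21 p1 hp] ->].
  have p2 := ltn_trans p21 p1.
  by rewrite inE /= /num /hf !inordK // p21 /= link_sym.
have edges13 : #|edges H| = 13 by rewrite (edges_card num_inj); lia.
pose s : seq H := [seq inord i | i <- iota 0 9].
have sS : fcycle (@ordS 9) s by rewrite /= -!val_eqE /= !inordK.
have s_uniq : uniq s.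
  rewrite map_inj_in_uniq ?iota_uniq // => i j; rewrite !mem_iota /= => lt_i lt_j.
  by move=> /(congr1 val); rewrite /= !inordK.
have s_mem (x : H) : x \in s.
  by apply/mapP; exists (num x); rewrite ?mem_iota ?ltn_ord // /num inord_val.
have next_s (x : H) : next s x = ordS x by apply/esym/eqP/(next_cycle sS)/s_mem.
have adjS (x : H) : x -- (ordS x : H).
  apply: (@occurs_link cycle9 f (num x) (num (ordS x))) => //; try exact: ltn_ord.
  by case: x => [[|[|[|[|[|[|[|[|[|//]]]]]]]]] ?].
have cyc_sub : cycle_edges s \subset edges H.
  apply/subsetP=> _ /imsetP[x _ ->]; rewrite next_s.
  by apply/imsetP; exists (x, ordS x : H); rewrite ?inE ?adjS.
have cyc9 : #|cycle_edges s| = 9.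
  rewrite card_in_imset => [|x y _ _]; first by rewrite (eq_card (B := H)) ?card_ord.
  rewrite !next_s => E; have := set2_eq (adj_neq (adjS x)) E => -[[-> //]|[yE xE]].
  have := congr1 val yE; have := congr1 val xE; rewrite /=.
  by case: x y {E yE xE} => [[|[|[|[|[|[|[|[|[|//]]]]]]]]] ?] [[|[|[|[|[|[|[|[|[|//]]]]]]]]] ?].
split.
(* A matching on nine vertices has at most four edges, and 13 exceeds 4 times 3. *)
- rewrite /overfull edges13; apply: (@leq_ltn_trans (4 * 3)) => //; apply: leq_mul.
    apply/bigmax_leqP=> M /andP[/subsetP M_edges /eqP trivM].
    have: \sum_(A in M) #|A| = \sum_(A in M) 2.
      apply: eq_bigr => A /M_edges/imsetP[[x y]]; rewrite inE => /(@adj_neq H) /= xy ->.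
      by rewrite cards2 xy.
    rewrite trivM sum_nat_const => E; have := max_card (mem (cover M)).
    rewrite E card_ord; lia.
  by apply/bigmax_leqP=> x _; apply: deg.
- split; first exact: card_ord.
  exists s; split; last by rewrite cardsD (setIidPr cyc_sub) edges13 cyc9.
    rewrite /ucycle s_uniq andbT; apply: sub_cycle sS => x y /eqP <-; exact: adjS.
  by rewrite size_map size_iota.
exact: (contains_line_graph (f := fun i : H => f (num i))).
Qed.

(** * Five-cycles of the root *)

Definition pentagon (f : nat -> V) : Prop :=
  {in gtn 5 &, injective f} /\ forall i, i < 5 -> h (f i) (f (i.+1 %% 5)).

Lemma pentagon_rot f r : pentagon f -> pentagon (fun i => f ((i + r) %% 5)).
Proof.
case=> f_inj f_h; split=> [i j|i] lt_i.
  move=> lt_j /f_inj; rewrite !inE !ltn_mod => /(_ isT isT)/eqP.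
  by rewrite eqn_modDr !modn_small // => /eqP.
have <- : ((i + r) %% 5).+1 %% 5 = (i.+1 %% 5 + r) %% 5.
  by rewrite -addn1 !modnDml addn1 addSn.
by apply: f_h; rewrite ltn_mod.
Qed.

(** Consecutive vertices of the induced cycle share an end. These five ends are distinct: if two
    coincided, at least three vertices of the cycle would be pairwise adjacent. *)
Lemma C5_pentagon : contains G (cycle_graph 5) -> exists f, pentagon f.
Proof.
case/contains_inv=> g g_inj g_adj.
have gS (i : 'I_5) : g i -- g (ordS i).
  by rewrite g_adj; case: i => [[|[|[|[|[|//]]]]] ?].
have ex (i : 'I_5) : exists u, (u \in ends (g i)) && (u \in ends (g (ordS i))).
  have [u u1 u2] := ends_adj (adj_neq (gS i)) (gS i).
  by exists u; rewrite u1.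
pose v i := xchoose (ex i).
have vP i : (v i \in ends (g i)) && (v i \in ends (g (ordS i))) := xchooseP (ex i).
have near (a b : cycle_graph 5) u : u \in ends (g a) -> u \in ends (g b) -> (a == b) || (a -- b).
  move=> ua ub; have [//|nab] := eqVneq a b; rewrite -g_adj.
  by apply/ends_adj; [rewrite (inj_eq g_inj)|exists u].
have v_inj : injective v.
  move=> i j vij; have /andP[i1 i2] := vP i; have /andP[] := vP j; rewrite -vij => j1 j2.
  have := near _ _ _ i1 j1; have := near _ _ _ i1 j2.
  have := near _ _ _ i2 j1; have := near _ _ _ i2 j2.
  rewrite /= /sym_rel -!val_eqE /= => n1 n2 n3 n4; apply/val_inj/eqP; move: n1 n2 n3 n4.
  by case: i j {vij i1 i2 j1 j2} => [[|[|[|[|[|//]]]]] ?] [[|[|[|[|[|//]]]]] ?].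
have hv i : h (v i) (v (ordS i)).
  have /andP[_ v1] := vP i; have /andP[v2 _] := vP (ordS i).
  have nv : v (ordS i) != v i.
    rewrite (inj_eq v_inj) -val_eqE; by case: i {v1 v2} => [[|[|[|[|[|//]]]]] ?].
  have [t _ xE] := ends_other v1; apply/linkP; exists (g (ordS i)); rewrite ?inE // xE.
  by move: v2; rewrite xE !inE (negPf nv) /= => /eqP->.
exists (fun n => v (inord n)); split=> [i j lt_i lt_j /v_inj/(congr1 val)|i lt_i].
  by rewrite /= !inordK.
have -> : inord (i.+1 %% 5) = ordS (inord i) :> 'I_5.
  by apply: val_inj; rewrite /= !inordK // ltn_mod.
exact: hv.
Qed.

(** * Critical sets of edges of the root *)

Section Critical.

Variable X : {set G}.
Hypothesis X_uncolorable : forall c, ~ coloring X c.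
Hypothesis X_minimal : forall Y, Y \proper X -> exists c, coloring Y c.

Lemma remove_coloring (Y : {set G}) x : x \in X -> x \in Y ->
  exists c, coloring (X :\: Y) c.
Proof.
move=> xX xY; apply: X_minimal; rewrite properEneq subsetDl andbT.
by apply/eqP=> /setP/(_ x); rewrite !inE xX xY.
Qed.

(** A colour missing around [x] could be given to [x], which would colour all of [X]. *)
Lemma full_nbrs x c i : x \in X -> coloring (X :\ x) c ->
  exists y, [/\ y \in X, x -- y & c y = i].
Proof.
move=> xX cP.
have [y /and3P[yX xy /eqP cy]|noy] := pickP (fun y => [&& y \in X, x -- y & c y == i]).
  by exists y.
case: (X_uncolorable (c := fun y => if y == x then i else c y)) => y z yX zX yz.
have noi t : t \in X -> x -- t -> c t != i.
  by move=> tX xt; have := noy t; rewrite /= tX xt => /negbT.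
have [yx|nyx] := eqVneq y x; have [zx|nzx] := eqVneq z x.
- by rewrite yx zx adj_irr in yz.
- by rewrite eq_sym noi // -yx.
- by rewrite noi // -zx adj_sym.
by apply: cP => //; rewrite !inE ?nyx ?nzx.
Qed.
Lemma link_incl u x : x \in X -> u \in ends x -> exists2 v, link X u v & ends x = [set u; v].
Proof. by move=> xX /ends_other[v _ E]; exists v => //; apply/linkP; exists x. Qed.

(* Around an edge of the root the adjacent edges see all three colours. *)
Lemma inc_link u v : link X u v -> 4 < #|inc X u| + #|inc X v|.
Proof.
case/linkP=> x xX xE.
have [c cP] := remove_coloring xX (set11 x).
have ux : u \in ends x by rewrite xE !inE eqxx.
have vx : v \in ends x by rewrite xE !inE eqxx orbT.
pose N := (inc X u :\ x) :|: (inc X v :\ x).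
have cN : c @: N = setT.
  apply/setP=> i; rewrite inE; have [y [yX xy <-]] := full_nbrs i xX cP.
  apply: imset_f; rewrite !inE -andb_orr eq_sym (adj_neq xy) yX /=.
  have [w] := ends_adj (adj_neq xy) xy.
  by rewrite xE !inE => /orP[]/eqP-> ->; rewrite ?orbT.
have : 3 <= #|N| by rewrite -[3]card_ord -cardsT -cN leq_imset_card.
have := (leq_card_setU (inc X u :\ x) (inc X v :\ x)).1.
have := cardsD1 x (inc X u); have := cardsD1 x (inc X v); rewrite !inE xX ux vx /=.
rewrite -/N; lia.
Qed.

(** The two degrees add up to at least 5 and each is at most 3. *)
Lemma link_degree u v : link X u v -> 1 < #|[set w | link X u w]|.
Proof. by move/inc_link; rewrite link_card; have := inc_card X v; lia. Qed.

Lemma mem_inc A u x : (x \in inc A u) = (x \in A) && (u \in ends x).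
Proof. by rewrite inE. Qed.

Lemma inc_adj A u x y : x \in inc A u -> y \in inc A u -> x != y -> x -- y.
Proof. by rewrite !mem_inc => /andP[_ ux] /andP[_ uy] nxy; apply/(ends_adj nxy); exists u. Qed.

(** * Kempe chains *)

Section Kempe.

Variables (a : G) (c : G -> 'I_3) (i j : 'I_3).
Hypothesis cP : coloring (X :\ a) c.

Definition kempe : rel G := fun x y =>
  [&& x \in X :\ a, y \in X :\ a, x -- y,
      (c x == i) || (c x == j) & (c y == i) || (c y == j)].

Lemma kempe_sym : symmetric kempe.
Proof. by move=> x y; rewrite /kempe adj_sym; apply/and5P/and5P => -[]; split. Qed.

(** Two chain neighbours of [x] at the same end would be adjacent, yet both carry the one colour of
    the pair that [x] does not have. So chains have degree at most 2, one neighbour per end. *)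
Lemma kempe_end u x y z : u \in ends y -> u \in ends z -> kempe x y -> kempe x z -> y = z.
Proof.
move=> uy uz /and5P[xX yX xy cx cy] /and5P[_ zX xz _ cz].
apply/eqP; apply: contraT => nyz.
have yz : y -- z by apply/(ends_adj nyz); exists u.
have := cP yX zX yz; have := cP xX yX xy; have := cP xX zX xz.
by case/orP: cx => /eqP->; case/orP: cy => /eqP->; case/orP: cz => /eqP->; rewrite ?eqxx.
Qed.

Lemma kempe_ends x y : kempe x y -> exists2 u, u \in ends x & u \in ends y.
Proof. by case/and5P=> _ _ xy _ _; apply/ends_adj => //; apply: adj_neq. Qed.

Lemma kempe_two x y1 y2 y3 : kempe x y1 -> kempe x y2 -> kempe x y3 ->
  [|| y1 == y2, y1 == y3 | y2 == y3].
Proof.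
move=> k1 k2 k3.
have [u ux u1] := kempe_ends k1; have [v _ xE] := ends_other ux.
have [w2 + w2y] := kempe_ends k2; have [w3 + w3y] := kempe_ends k3.
rewrite xE !inE => /orP[]/eqP E3 /orP[]/eqP E2; subst w2 w3.
- by rewrite (kempe_end u1 w2y k1 k2) eqxx.
- by rewrite (kempe_end u1 w3y k1 k3) eqxx orbT.
- by rewrite (kempe_end u1 w2y k1 k2) eqxx.
by rewrite (kempe_end w2y w3y k2 k3) eqxx !orbT.
Qed.

Lemma kempe_swap s : s \in X :\ a -> (c s == i) || (c s == j) ->
  coloring (X :\ a) (fun x => if connect kempe s x then tperm i j (c x) else c x).
Proof.
move=> sX cs.
have compP x : connect kempe s x -> (c x == i) || (c x == j).
  case/connectP=> p; elim/last_ind: p => [_ ->//|p y _].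
  by rewrite rcons_path last_rcons => /andP[_ /and5P[]] ? ? ? ? ? ->.
have cross x y : x \in X :\ a -> y \in X :\ a -> x -- y ->
    connect kempe s x -> ~~ connect kempe s y -> tperm i j (c x) != c y.
  move=> xX yX xy sx nsy.
  have : ~~ ((c y == i) || (c y == j)).
    apply: contra nsy => cy; apply: (connect_trans sx (connect1 _)).
    by apply/and5P; split=> //; apply: compP.
  rewrite negb_or => /andP[nyi nyj].
  by case/orP: (compP x sx) => /eqP->; rewrite ?tpermL ?tpermR eq_sym.
move=> x y xX yX xy; case: ifP => sx; case: ifP => sy.
- by rewrite (inj_eq perm_inj) cP.
- by rewrite cross ?sy.
- by rewrite eq_sym cross ?sx // adj_sym.
exact: cP.
Qed.

End Kempe.

(* Remove one edge at a common neighbour and colour the rest: otherwise three chain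
   ends, each of Kempe degree at most 1, would lie in a single Kempe chain. *)
Lemma two_far u v : #|[set w | link X u w]| = 2 -> #|[set w | link X v w]| = 2 ->
  u != v -> link X u v \/ (exists2 w, link X u w & link X w v) -> False.
Proof.
rewrite !link_card => u2 v2 nuv [/inc_link|[w uw wv]]; first by rewrite u2 v2.
have /linkP[a aX aE] := uw; have /linkP[b bX bE] := wv.
have nuw := ends_neq aE; have nwv := ends_neq bE.
have aa : a \in inc X u by rewrite mem_inc aX aE !inE eqxx.
have bb : b \in inc X v by rewrite mem_inc bX bE !inE eqxx orbT.
have aw : a \in inc X w by rewrite mem_inc aX aE !inE eqxx orbT.
have bw : b \in inc X w by rewrite mem_inc bX bE !inE eqxx.
have nba : b != a.
  apply/eqP=> E; have : u \in ends b by rewrite E aE !inE eqxx.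
  by rewrite bE !inE (negPf nuw) (negPf nuv).
(* Local picture: the path [u w v] with edges [a] and [b]; [a2] and [b2] are the second edges at [u]
   and [v], and [d] is the third edge at [w]. *)
have [a2 uE] : exists a2, inc X u :\ a = [set a2].
  exact/cards1P/eqP/(cards_remove aa u2).
have [b2 vE] : exists b2, inc X v :\ b = [set b2].
  exact/cards1P/eqP/(cards_remove bb v2).
have w3 : #|inc X w| = 3.
  apply/eqP; rewrite eqn_leq inc_card /=.
  by have := inc_link uw; rewrite u2 -[4]/(2 + 2) ltn_add2l.
have [d wE] : exists d, inc X w :\ a :\ b = [set d].
  apply/cards1P/eqP/cards_remove; first by rewrite in_setD1 nba.
  exact: cards_remove w3.
have memD1 A x y : (A :\ x = [set y]) -> forall t, t \in A -> t != x -> t = y.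
  by move=> AE t tA ntx; apply/set1P; rewrite -AE in_setD1 ntx.
have in1 A x y : (A :\ x = [set y]) -> y != x /\ y \in A.
  by move=> AE; have := set11 y; rewrite -AE in_setD1 => /andP.
have [na2 a2u] := in1 _ _ _ uE; have [nb2 b2v] := in1 _ _ _ vE.
have [ndb] := in1 _ _ _ wE; rewrite in_setD1 => /andP[nda dw].
have toX y t : y \in inc X t -> y != a -> y \in X :\ a.
  by rewrite in_setD1 mem_inc => /andP[-> _] ->.
have a2X := toX _ _ a2u na2; have dX := toX _ _ dw nda; have bXa := toX _ _ bw nba.
have nb2a : b2 != a.
  apply/eqP=> E; move: b2v; rewrite mem_inc E aE !inE => /andP[_] /orP[]/eqP E'.
    by rewrite E' eqxx in nuv.
  by rewrite E' eqxx in nwv.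
have b2X := toX _ _ b2v nb2a.
have na2b : a2 != b.
  apply/eqP=> E; move: a2u; rewrite mem_inc E bE !inE => /andP[_] /orP[]/eqP E'.
    by rewrite E' eqxx in nuw.
  by rewrite E' eqxx in nuv.
have end_in A x t : x \in inc A t -> t \in ends x by rewrite mem_inc => /andP[].
have na2d : a2 != d.
  apply/eqP=> E; rewrite -E in dw; case/eqP: na2.
  by apply/esym/(ends_eq aE); [apply: end_in a2u|apply: end_in dw].
have nb2d : b2 != d.
  apply/eqP=> E; rewrite -E in dw; case/eqP: nb2.
  by apply/esym/(ends_eq bE); [apply: end_in dw|apply: end_in b2v].
have na2b2 : a2 != b2.
  apply/eqP=> E; rewrite -E in b2v.
  apply: (@ends_triangle a b a2 u w v) => //; rewrite ?aE ?bE ?inE ?eqxx ?orbT //.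
    exact: end_in b2v.
  exact: end_in a2u.
(* The edges [a2], [b], [d] are all the neighbours of [a], so they must show all three colours. *)
have three c : coloring (X :\ a) c -> uniq [:: c a2; c b; c d].
  move=> cP; apply: (leq_size_uniq (enum_uniq 'I_3)); last by rewrite size_enum_ord.
  move=> i _; have [y [yX ay <-]] := full_nbrs i aX cP.
  have nya : y != a by rewrite eq_sym adj_neq.
  have [t] := ends_adj (adj_neq ay) ay.
  rewrite aE !inE => /orP[]/eqP-> ty.
    by rewrite (memD1 _ _ _ uE y) ?mem_inc ?yX ?ty // eqxx.
  have [->|nyb] := eqVneq y b; first by rewrite eqxx orbT.
  by rewrite (memD1 _ _ _ wE y) ?in_setD1 ?mem_inc ?nya ?yX ?ty // eqxx !orbT.
(* If [b2] and [d] had the same colour, [b] would see no other and could take the colour of [a2],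
   contradicting [three]. *)
have recolor c : coloring (X :\ a) c -> c b2 != c d.
  move=> cP; apply/eqP=> cE; have := three c cP.
  rewrite /= !inE negb_or andbT => /andP[/andP[_ nca] _].
  have nbr y : y \in X :\ a -> b -- y -> c y = c d.
    rewrite in_setD1 => /andP[nya yX] b_y; have nyb : y != b by rewrite eq_sym adj_neq.
    have [t] := ends_adj (adj_neq b_y) b_y; rewrite bE !inE => /orP[]/eqP-> ty.
      by rewrite (memD1 _ _ _ wE y) ?in_setD1 ?mem_inc ?nya ?yX ?ty.
    by rewrite -cE (memD1 _ _ _ vE y) ?mem_inc ?yX ?ty.
  have c'P : coloring (X :\ a) (fun x => if x == b then c a2 else c x).
    move=> x y xX yX xy; have [xb|nxb] := eqVneq x b; have [yb|nyb] := eqVneq y b.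
    - by rewrite xb yb adj_irr in xy.
    - by rewrite (nbr y) // -xb.
    - by rewrite eq_sym (nbr x) // -yb adj_sym.
    exact: cP.
  by have := three _ c'P; rewrite /= !inE (negPf na2b) !eqxx.
have [c cP] := remove_coloring aX (set11 a).
have := three c cP; rewrite /= !inE negb_or andbT => /andP[/andP[nc_a2b nc_a2d] nc_bd].
have nc_b2d := recolor c cP.
have nc_b2b : c b2 != c b.
  by apply: cP => //; apply: inc_adj b2v bb _.
have cb2 : c b2 = c a2.
  by move: (c a2) (c b) (c d) (c b2) nc_a2b nc_a2d nc_bd nc_b2d nc_b2b;
     do 4!case=> [[|[|[|//]]] ?] //=; move=> *; apply: val_inj.
(* Now [b2] shares the colour of [a2], and [b] has the third colour, so it lies on no chain of this
   pair. *)
pose e := kempe a c (c a2) (c d).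
have a2c : (c a2 == c a2) || (c a2 == c d) by rewrite eqxx.
have b2c : (c b2 == c a2) || (c b2 == c d) by rewrite cb2 eqxx.
case: (boolP (connect e a2 d)) => [conn_d|nconn].
  case: (boolP (connect e a2 b2)) => [conn_b2|nconn].
    (* At [u], [v] and [w] respectively, the chain edges [a2], [b2] and [d] have no chain neighbour:
       the only other edges there are the removed [a] and the edge [b]. *)
    have e_b x : e x b = false.
      apply/negP=> /and5P[_ _ _ _]; rewrite ![c b == _]eq_sym.
      by rewrite (negPf nc_a2b) eq_sym (negPf nc_bd).
    have e_a x : e x a = false by rewrite /e /kempe setD11 andbF.
    have end1 x t : x \in inc X t ->
        (forall y, y \in inc X t -> y != x -> e x y = false) ->
        forall y1 y2, e x y1 -> e x y2 -> y1 = y2.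
      move=> /end_in tx noE y1 y2 e1 e2; have [s _ xE] := ends_other tx.
      have other y : e x y -> s \in ends y.
        move=> exy; have [r] := kempe_ends exy; rewrite xE !inE => /orP[]/eqP-> // ty.
        case/and5P: (exy) => _ yX xy _ _.
        rewrite noE // in exy; last by rewrite eq_sym adj_neq.
        by rewrite mem_inc ty andbT; case/setD1P: yX.
      by apply: (kempe_end cP (other _ e1) (other _ e2) e1 e2).
    apply: (two_ended (kempe_sym a c _ _) _ _ _ conn_b2 conn_d) => [|x|].
    - exact: kempe_two.
    - rewrite !inE => /or3P[]/eqP->.
      + apply: (end1 _ _ a2u) => y yu nya2; have [->//|nya] := eqVneq y a.
        by rewrite (memD1 _ _ _ uE y) // eqxx in nya2.
      + apply: (end1 _ _ b2v) => y yv nyb2; have [->//|nyb] := eqVneq y b.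
        by rewrite (memD1 _ _ _ vE y) // eqxx in nyb2.
      apply: (end1 _ _ dw) => y yw nyd; have [->//|nya] := eqVneq y a.
      have [->//|nyb] := eqVneq y b.
      by rewrite (memD1 _ _ _ wE y) ?in_setD1 ?nya // eqxx in nyd.
    by rewrite /= !inE negb_or na2b2 na2d nb2d.
  (* The swap at [b2] gives it the colour of [d] without touching [d]. *)
  have := recolor _ (kempe_swap cP b2X b2c); rewrite connect0 cb2 tpermL.
  case: ifP => [conn|_]; last by rewrite eqxx.
  case/negP: nconn; apply: (connect_trans conn_d).
  by rewrite (sym_connect_sym (kempe_sym a c _ _)).
(* The swap at [a2] gives it the colour of [d] without touching [d]. *)
have := three _ (kempe_swap cP a2X a2c).
by rewrite connect0 (negPf nconn) tpermL /= !inE !eqxx orbT.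
Qed.

(* A transposition of the colours on [D] makes the colour missing at [r] equal to the
   colour used there by the remaining edge. *)
Lemma closed_false D r : D != [::] -> proper_list D ->
  {in D, forall d, link X d.1.1 d.1.2 && (d.2 < 3)} ->
  (forall u v w, lists D u v -> u != r -> link X u w -> lists D u w) ->
  (forall w, link X r w -> lists D r w) \/
    (exists a b, [/\ a != b, lists D r a & lists D r b]) ->
  False.
Proof.
move=> D0 prD linkD sat sat_r.
pose is_end x (d : (V * V) * nat) := ends x == [set d.1.1; d.1.2].
pose Y := [set x in X | has (is_end x) D].
pose col x : 'I_3 := inord (nth ((r, r), 0) D (find (is_end x) D)).2.
have colP x : x \in Y ->
    exists2 d, d \in D & ends x = [set d.1.1; d.1.2] /\ val (col x) = d.2.
  rewrite inE => /andP[_ hasD]; exists (nth ((r, r), 0) D (find (is_end x) D)).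
    by rewrite mem_nth // -has_find.
  split; first exact/eqP/(nth_find _ hasD).
  rewrite /col /= inordK //.
  by have /linkD/andP[] := mem_nth ((r, r), 0) (etrans (esym (has_find _ _)) hasD).
have memY x u v : x \in X -> ends x = [set u; v] -> (x \in Y) = lists D u v.
  move=> xX xE; rewrite inE xX; apply: eq_has => d; rewrite /is_end xE.
  apply/eqP/orP => [/(set2_eq (ends_neq xE))|].
    by case=> <-; rewrite -surjective_pairing eqxx; [left|right].
  by case=> /eqP->; rewrite // setUC.
have subYX x : x \in Y -> x \in X by rewrite inE => /andP[].
have colY x y : x \in Y -> y \in Y -> x -- y -> col x != col y.
  move=> /colP[d dD [xE cx]] /colP[e eD [yE cy]] xy.
  rewrite -val_eqE cx cy; apply: (proper_listP prD) => //.
    apply: contraTneq xy => E; suff -> : x = y by rewrite adj_irr.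
    by apply: (ends_eq xE); rewrite yE -E !inE eqxx ?orbT.
  have [t] := ends_adj (adj_neq xy) xy; rewrite xE yE /touch !inE.
  by case/orP=> /eqP-> /orP[]->; rewrite ?orbT.
have [x0 x0Y] : exists x, x \in Y.
  have [d dD] : exists d, d \in D.
    by case: (D) D0 => [//|d D'] _; exists d; rewrite mem_head.
  have /andP[/linkP[x xX xE] _] := linkD d dD.
  by exists x; rewrite inE xX; apply/hasP; exists d; rewrite // /is_end xE.
have [c cP] := remove_coloring (subYX _ x0Y) x0Y.
(* Listed and unlisted critical edges meet only at [r], because every other vertex of [D] is
   complete. *)
have boundary x y : x \in Y -> y \in X -> y \notin Y -> x -- y ->
    [/\ r \in ends x, r \in ends y &
      exists a b, [/\ a != b, lists D r a & lists D r b]].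
  move=> xY yX yY xy; have [t tx ty] := ends_adj (adj_neq xy) xy.
  have [v _ xE] := ends_other tx; have [w _ yE] := ends_other ty.
  have ltv : lists D t v by rewrite -(memY x) // subYX.
  have ktw : link X t w by apply/linkP; exists y.
  have [tr|ntr] := eqVneq t r.
    rewrite -tr; split=> //; case: sat_r => [/(_ w)|]; rewrite -tr // => /(_ ktw).
    by rewrite -(memY y) // (negPf yY).
  by have := sat t v w ltv ntr ktw; rewrite -(memY y) // (negPf yY).
have [p pP] : exists p : {perm 'I_3},
    forall x y, x \in Y -> y \in X -> y \notin Y -> x -- y -> p (col x) != c y.
  have [y0 /andP[/andP[y0X y0Y] y0r]|noy] :=
      pickP (fun y => (y \in X) && (y \notin Y) && (r \in ends y)); last first.
    exists 1%g => x y xY yX yY xy; have [_ ry _] := boundary x y xY yX yY xy.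
    by have := noy y; rewrite yX yY ry.
  case: sat_r => [satr|[a [b [nab la lb]]]].
    have [v _ yE] := ends_other y0r.
    have := satr v; rewrite -(memY y0) // (negPf y0Y) => H.
    by case: notF; apply: H; apply/linkP; exists y0.
  have getx v : lists D r v -> exists x, [/\ x \in Y, ends x = [set r; v] & x \in inc X r].
    move=> lv; have : link X r v.
      by case/hasP: (lv) => d dD /orP[]/eqP dE; have /linkD/andP[] := dD; rewrite dE // link_sym.
    case/linkP=> x xX xE; exists x; split=> //; first by rewrite (memY x r v).
    by rewrite mem_inc xX xE !inE eqxx.
  have [xa [xaY xaE xar]] := getx a la; have [xb [xbY xbE xbr]] := getx b lb.
  have nxab : xa != xb.
    apply: contraNneq nab => E; rewrite E xbE in xaE.
    have /setP/(_ a) := xaE; rewrite !inE eqxx orbT.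
    have : r != a by apply: (@ends_neq xb); rewrite xbE xaE.
    by rewrite eq_sym => /negPf->.
  (* Three edges fill the degree bound at [r], so [y0] is the only critical edge there outside
     [Y]. *)
  have incE : inc X r = [set y0; xa; xb].
    apply/esym/eqP; rewrite eqEcard; apply/andP; split.
      apply/subsetP=> x; rewrite !inE -orbA => /or3P[]/eqP-> //; rewrite -?(mem_inc X r) //.
      by rewrite mem_inc y0X.
    apply: leq_trans (inc_card X r) _; rewrite -setUA cardsU1 cards2 nxab !inE negb_or.
    have [-> ->] // : y0 != xa /\ y0 != xb.
    by split; apply: contraNneq y0Y => ->.
  have ncab : col xa != col xb by apply: colY => //; apply: inc_adj xar xbr nxab.
  have [m nma nmb] : exists2 m, m != col xa & m != col xb.
    move: (col xa) (col xb) ncab => [[|[|[|//]]] ?] [[|[|[|//]]] ?] //= _;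
    by [exists (inord 0); rewrite -val_eqE /= inordK|exists (inord 1); rewrite -val_eqE /= inordK
       |exists (inord 2); rewrite -val_eqE /= inordK].
  exists (tperm m (c y0)) => x y xY yX yY xy.
  have [rx ry _] := boundary x y xY yX yY xy.
  have yy0 : y = y0.
    have : y \in inc X r by rewrite mem_inc yX.
    by rewrite incE !inE -orbA => /or3P[]/eqP // E; rewrite E ?xaY ?xbY in yY.
  have nxm : col x != m.
    have : x \in inc X r by rewrite mem_inc subYX.
    rewrite incE !inE -orbA => /or3P[]/eqP E; last 2 first.
    - by rewrite E eq_sym.
    - by rewrite E eq_sym.
    by rewrite E (negPf y0Y) in xY.
  by rewrite yy0 -{2}(tpermL m (c y0)) (inj_eq perm_inj).
case: (X_uncolorable (c := fun x => if x \in Y then p (col x) else c x)) => x y xX yX xy.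
case: ifP => xY; case: ifP => yY.
- by rewrite (inj_eq perm_inj) colY.
- by rewrite pP // yY.
- by rewrite eq_sym pP // ?xY // adj_sym.
by apply: cP; rewrite // in_setD ?xY ?yY.
Qed.

(** * Exclusion of five-cycles *)

Section NoPentagon.

Hypothesis G_connected : connected G.
Hypothesis no_spider : forall f, ~ occurs h spider f.
Hypothesis no_K33 : forall f, ~ occurs h K33_subdivided f.
Hypothesis no_petersen : forall f, ~ occurs h petersen_minus f.
Hypothesis no_cycle9 : forall f, occurs h cycle9 f ->
  12 < count (fun p => h (f p.1) (f p.2)) pairs9 -> False.

Notation k := (link X).

Lemma h_degree u : #|[set w | h u w]| <= 3.
Proof. by rewrite link_card inc_card. Qed.

Lemma refute_X d st cs f : refute d st cs -> ~ realizes h k st f.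
Proof.
move=> ref fP; apply: (refute_sound _ _ _ _ _ _ _ _ _ no_spider no_K33 no_petersen no_cycle9 ref).
- exact: link_sym.
- exact: link_irr.
- exact: link_sym.
- exact/link_sub/subsetT.
- exact: h_degree.
- exact: link_triangle.
- exact: link_degree.
- exact: two_far.
- exact: closed_false.
by exists f.
Qed.

Definition met (u : V) : bool := [exists v, k u v].

Lemma met_ends x u : x \in X -> u \in ends x -> met u.
Proof. by move=> xX /(link_incl xX)[v kuv _]; apply/existsP; exists v. Qed.

Lemma unmet_h u v : ~~ met u -> ~~ k u v.
Proof. by apply: contra => kuv; apply/existsP; exists v. Qed.

(** The exit is already one leg of a spider centred at [v]. The edge [v q] serves as the first known
    edge of the critical part. *)
Lemma no_long_exit v w1 w2 w3 : met v -> ~~ met w1 -> ~~ met w2 -> ~~ met w3 ->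
  h v w1 -> h w1 w2 -> h w2 w3 -> w1 != w3 -> False.
Proof.
move=> vX w1X w2X w3X h1 h2 h3 nw13; have /existsP[q kvq] := vX.
have qX : met q by apply/existsP; exists v; rewrite link_sym.
apply: (@refute_X 20 exit_state exit_script (nth v [:: v; w1; w2; w3; q])).
  exact: exit_refuted.
have neq a b : met a -> ~~ met b -> a != b by move=> aX; apply: contraNneq => <-.
have hneq a b : h a b -> a != b by apply: contraTneq => ->; rewrite link_irr.
have kneq : v != q by apply: contraTneq kvq => ->; rewrite link_irr.
split=> //=.
- have un : uniq [:: v; w1; w2; w3; q].
    rewrite /= !inE !negb_or (neq v w1) // (neq v w2) // (neq v w3) // kneq.
    rewrite (hneq _ _ h2) (hneq _ _ h3) nw13 ![_ == q]eq_sym.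
    by rewrite (neq q w1) // (neq q w2) // (neq q w3).
  by move=> i j lt_i lt_j /eqP; rewrite nth_uniq // => /eqP.
- by move=> e; rewrite !inE => /eqP->.
- move=> e; rewrite !inE => /or3P[]/eqP-> /=.
  + by rewrite h1 link_sym unmet_h.
  + by rewrite h2 unmet_h.
  by rewrite h3 unmet_h.
have k0 u : ~~ met u -> [set w | k u w] == set0.
  by move=> mu; apply/eqP/setP=> w; rewrite !inE (negPf (unmet_h w mu)).
by move=> i; rewrite !inE => /or3P[]/eqP->; rewrite /= k0.
Qed.

(** Two non-critical edges of the cycle and at least two critical edges at the same vertex would
    exceed degree 3. *)
Lemma pentagon_unmet f : pentagon f ->
  (forall i, i < 5 -> ~~ k (f i) (f (i.+1 %% 5))) -> forall i, i < 5 -> ~~ met (f i).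
Proof.
move=> [f_inj f_h] f_k i lt_i; apply/negP=> /existsP[q kq].
pose j := (i + 4) %% 5; pose l := i.+1 %% 5.
have lt_j : j < 5 by rewrite ltn_mod.
have lt_l : l < 5 by rewrite ltn_mod.
have jE : j.+1 %% 5 = i by rewrite -addn1 modnDml -addnA modnDr modn_small.
have hj : h (f i) (f j) by rewrite link_sym; have := f_h j lt_j; rewrite jE.
have hl : h (f i) (f l) := f_h i lt_i.
have kj : ~~ k (f i) (f j) by rewrite link_sym; have := f_k j lt_j; rewrite jE.
have kl : ~~ k (f i) (f l) := f_k i lt_i.
have njl : f j != f l.
  apply/eqP=> /(f_inj _ _ lt_j lt_l); rewrite /j /l.
  by case: i lt_i {j l lt_j lt_l jE hj hl kj kl kq} => [|[|[|[|[|]]]]].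
have := h_degree (f i); apply/negP; rewrite -ltnNge.
have sub : [set w | k (f i) w] :|: [set f j; f l] \subset [set w | h (f i) w].
  apply/subsetP=> w; rewrite !inE => /or3P[|/eqP->|/eqP->] //.
  exact/link_sub/subsetT.
apply: leq_trans (subset_leq_card sub).
rewrite cardsU cards2 njl [X in _ - X]eq_card0 ?subn0.
  by rewrite -[3]/(1 + 2) ltn_add2r (link_degree kq).
by move=> w; rewrite !inE; apply/negP=> /andP[kw /orP[]/eqP E]; rewrite E in kw;
  [case/negP: kj|case/negP: kl].
Qed.

Lemma pentagon_outside f : pentagon f ->
  (forall i, i < 5 -> ~~ k (f i) (f (i.+1 %% 5))) -> False.
Proof.
move=> fP f_k; have f_unmet := pentagon_unmet fP f_k; have [f_inj f_h] := fP.
pose r : rel V := fun u v => [&& h u v, ~~ met u & ~~ met v].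
have r_sym : symmetric r by move=> u v; rewrite /r link_sym [X in _ && X]andbC.
have unmet_r u : connect r (f 0) u -> ~~ met u.
  case/connectP=> p; elim/last_ind: p => [_ -> |p v _]; first exact: f_unmet.
  by rewrite rcons_path last_rcons => /andP[_ /and3P[_ _ mv]] ->.
(* If walks along unmet vertices never came next to a met vertex, the edges having an end on such a
   walk would be closed under adjacency; by connectedness they would include an edge of [X]. *)
have [v [w [wP vX hvw]]] : exists v w, [/\ connect r (f 0) w, met v & h v w].
  apply: NNPP => none.
  have step u v : connect r (f 0) u -> h u v -> connect r (f 0) v.
    move=> uP huv; apply: connect_trans (uP) (connect1 _).
    rewrite /r huv unmet_r //=; apply/negP=> mv; apply: none.
    by exists v, u; rewrite link_sym.
  pose S := [pred x | [exists u in ends x, connect r (f 0) u]].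
  have S_closed : closed (@adj G) S.
    apply: intro_closed; first by apply/sym_connect_sym/adj_sym.
    move=> x y xy /exists_inP[u ux uP].
    have [v vx vy] := ends_adj (adj_neq xy) xy; apply/exists_inP; exists v => //.
    have [t _ xE] := ends_other ux; move: vx; rewrite xE !inE => /orP[]/eqP-> //.
    by apply: (step u) => //; apply/linkP; exists x.
  have [x0 _ x0E] := linkP _ _ _ (f_h 0 isT).
  have x0S : x0 \in S by apply/exists_inP; exists (f 0); rewrite ?x0E ?inE ?eqxx.
  have [x xX] : exists x, x \in X.
    apply/set0Pn/eqP=> X0; apply: (X_uncolorable (c := fun _ => ord0)) => x y.
    by rewrite X0 inE.
  have : x \in S by rewrite -(closed_connect S_closed (G_connected x0 x)).
  by case/exists_inP=> u ux /unmet_r/negP[]; apply: met_ends ux.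
have mw := unmet_r w wP.
(* The exit through [w] is prolonged to length 3: along the 5-cycle as soon as it is reached, and
   otherwise along the walk back to [f 0]. *)
have [[i lt_i wE]|no_i] : (exists2 i, i < 5 & w = f i) \/ (forall i, i < 5 -> w != f i).
  case: (boolP (has (fun i => w == f i) (iota 0 5))) => [/hasP[i]|/hasPn no_i].
    by rewrite mem_iota => lt_i /eqP->; left; exists i.
  by right=> i lt_i; apply: no_i; rewrite mem_iota.
  have lt_s j : j.+1 %% 5 < 5 by rewrite ltn_mod.
  apply: (no_long_exit vX mw (f_unmet _ (lt_s i)) (f_unmet _ (lt_s _)) hvw _ (f_h _ (lt_s _))).
    by rewrite wE f_h.
  rewrite wE; apply/eqP=> /(f_inj _ _ lt_i (lt_s _)).
  by case: i lt_i {wE} => [|[|[|[|[|]]]]].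
have : connect r w (f 0) by rewrite (sym_connect_sym r_sym).
case/connectP=> p rp; case/shortenP: rp => [[|w2 p'] /= rp up _ wf].
  by have := no_i 0 isT; rewrite wf eqxx.
case/andP: rp => /and3P[h2 _ mw2] rp.
case: (boolP (has (fun i => w2 == f i) (iota 0 5))) => [/hasP[i]|/hasPn no_i2].
  rewrite mem_iota => lt_i /eqP w2E; have lt_s : i.+1 %% 5 < 5 by rewrite ltn_mod.
  apply: (no_long_exit vX mw mw2 (f_unmet _ lt_s) hvw h2); last exact: no_i.
  by rewrite w2E f_h.
case: p' rp up wf => [_ _ /= wf|w3 p' /= /andP[/and3P[h3 _ mw3] _] /andP[up _] _].
  by have := no_i2 0; rewrite mem_iota wf eqxx => /(_ isT).
apply: (no_long_exit vX mw mw2 mw3 hvw h2 h3).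
by apply: contraNneq up => ->; rewrite !inE eqxx orbT.
Qed.

Lemma no_pentagon f : ~ pentagon f.
Proof.
move=> fP; pose p := [seq k (f i) (f (i.+1 %% 5)) | i <- iota 0 5].
case: (boolP (has id p)) => [has_p|/hasPn no_p]; last first.
  apply: (pentagon_outside fP) => i lt_i; apply: no_p; apply/mapP.
  by exists i; rewrite ?mem_iota.
have [|r lt_r rP] := patterns_rot _ has_p; first by rewrite size_map.
pose g i := f ((i + r) %% 5); have [g_inj g_h] : pentagon g := pentagon_rot r fP.
pose b (e : nat * nat) := k (g e.1) (g e.2).
have pE : rot r p = map b cycle5.
  by rewrite /b /g /p; case: r lt_r {rP g g_inj g_h b} => [|[|[|[|[|//]]]]].
apply: (refute_X (allP patterns_refuted _ rP) (f := g)); rewrite pE /cycle_state.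
rewrite -map_comp -!filter_mask.
have cycP e : e \in cycle5 -> [&& e.1 < 5, e.2 < 5 & h (g e.1) (g e.2)].
  have gh i : i < 5 -> h (g i) (g (i.+1 %% 5)) by apply: g_h.
  rewrite !inE => /or4P[/eqP->|/eqP->|/eqP->|/orP[]/eqP->] /=.
  - exact: (gh 0).
  - exact: (gh 1).
  - exact: (gh 2).
  - exact: (gh 3).
  exact: (gh 4).
move: (cycle5) cycP => s cycP.
split=> //= e; rewrite mem_filter => /andP[be /cycP/and3P[-> -> he]] //.
by rewrite he.
Qed.

End NoPentagon.

End Critical.

End Root.

(** * A minimal uncolourable set, and the conclusion *)

Lemma coloring_minimal (G : sgraph) : ~ colorable 3 G ->
  exists X : {set G}, (forall c, ~ coloring X c) /\
    forall Y : {set G}, Y \proper X -> exists c, coloring Y c.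
Proof.
move=> no_col.
(* Ranging over finite functions makes uncolourability a boolean property, so that a minimal set
   exists. *)
pose P (A : {set G}) := ~~ [exists c : {ffun G -> 'I_3},
  [forall x in A, forall y in A, (x -- y) ==> (c x != c y)]].
have PP (A : {set G}) : reflect (exists c, coloring A c) (~~ P A).
  rewrite negbK; apply: (iffP existsP) => -[c cP].
    exists c => x y xA yA xy.
    by have /forall_inP/(_ y yA)/implyP/(_ xy) := forall_inP cP x xA.
  exists (finfun c); apply/forall_inP=> x xA; apply/forall_inP=> y yA.
  by apply/implyP=> xy; rewrite !ffunE cP.
have PT : P [set: G].
  apply: contraT => /PP[c cP]; case: no_col; exists c => x y; exact: cP.
have [X /minsetP[PX X_min] _] := minset_exists PT.
exists X; split=> [c cP|Y YX].
  by case/PP/negP: (ex_intro (coloring X) c cP).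
apply/PP/negP=> PY; have := X_min _ PY (proper_sub YX) => E.
by rewrite E properxx in YX.
Qed.

Theorem theorem6 (G : sgraph)
  (G_connected : connected G)
  (G_claw_free : ~ contains G claw)
  (G_diamond_free : ~ contains G diamond)
  (G_N222_free : ~ contains G N222)
  (G_C5 : contains G (cycle_graph 5)) :
  contains G (complete_graph 4) \/
  contains G B10 \/
  contains G (line_graph petersen_minus_vertex) \/
  (exists H : sgraph,
     [/\ overfull H, cycle_with_chords 9 4 H & contains G (line_graph H)]) \/
  colorable 3 G.
Proof.
apply: NNPP => /not_or_and[noK4 /not_or_and[noB10 /not_or_and[noP /not_or_and[no9 nocol]]]].
have [X [X_unc X_min]] := coloring_minimal nocol.
(* The 5-cycle provides a second vertex, and connectedness then gives every vertex a neighbour. *)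
have isolated_free (x : G) : exists y, x -- y.
  have [g g_inj _] := contains_inv G_C5.
  have [z nzx] : exists z, z != x.
    have [E|] := eqVneq (g ord0) x; last by exists (g ord0).
    by exists (g ord_max); rewrite -E (inj_eq g_inj).
  have /connectP[[|y p] /= xp zE] := G_connected x z; first by rewrite zE eqxx in nzx.
  by exists y; case/andP: xp.
have e_card := root_ends_card G_claw_free G_diamond_free noK4 isolated_free.
have e_inj := root_ends_inj G_diamond_free noK4.
have e_adj := root_ends_adj G_diamond_free noK4.
have e_deg := root_ends_degree G_diamond_free noK4.
have e_tri := root_ends_triangle G_claw_free G_diamond_free noK4 isolated_free.
have [f fP] := C5_pentagon e_card e_adj G_C5.
apply: (no_pentagon e_card e_inj e_adj e_deg e_tri X_unc X_min G_connected _ _ _ _ fP) => g gP.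
- exact: G_N222_free (spider_N222 e_adj gP).
- exact: noB10 (K33_B10 e_adj gP).
- exact: noP (petersen_minus_vertex_line e_adj gP).
by move=> chords; apply: no9; apply: (cycle9_overfull e_card e_inj e_adj e_deg gP).
Qed.
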